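(* Let $\mathfrak{M}=(W;L_1,\dots,L_l;P)$ be an $(n,l)$-dimensional KSM-data with curvature vectors $\bm{\mu}_1,\dots,\bm{\mu}_n$, let $V=\sum_k c_kv_k$ be a fiber-directed holomorphic vector field on the KSM-manifold $Z_{\mathfrak{M}}$, and let $\sigma$ be an admissible function for $V$. Then the $(\sigma,V)$-Ding functional $D_V^\sigma$ is coercive if and only if for every $k=1,\dots,l$ $$\int_{P^*} z_k\prod_{\alpha=1}^n\left(1+\langle\bm{\mu}_\alpha,\bm{z}\rangle\right)e^{-\sigma(-\langle \bm{c},\bm{z}\rangle+C_V)}\,d\bm{z}=0 .$$
   Context: Fano polytope: a convex polytope $P\subset\mathbb{R}^l$ is an $l$-dimensional Fano polytope if (i) its vertices lie in $\mathbb{Z}^l$; (ii) $\bm{0}\in\mathrm{Int}(P)$; (iii) every facet is a simplex; (iv) the vertices of every facet form a $\mathbb{Z}$-basis of $\mathbb{Z}^l$. Its dual polytope is $P^*=\{\bm{z}\in\mathbb{R}^l : \langle \bm{z},\bm{y}\rangle\le 1\ \text{for all } \bm{y}\in P\}$. KSM-data: $\mathfrak{M}=(W;L_1,\dots,L_l;P)$ is an $(n,l)$-dimensional KSM-data if (i) $W$ is an $n$-dimensional Fano manifold with a Kähler form $\nu_0$ with $\mathrm{Ric}(\nu_0)=\nu_0$; (ii) each $L_i$ is a holomorphic line bundle over $W$ with a Hermitian metric $h_i$ whose curvature form $-\sqrt{-1}\partial\overline{\partial}\log h_i$ has constant eigenvalues $\mu^{(i)}_1,\dots,\mu^{(i)}_n$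 with respect to $\nu_0$; (iii) near every $w\in W$ there are holomorphic coordinates $(z_1,\dots,z_n)$ and holomorphic local frames $e_i$ of $L_i$ such that, at $w$, simultaneously $\nu_0=\sqrt{-1}\sum_\alpha dz_\alpha\wedge d\overline{z_\alpha}$, $h_i(e_i,e_i)=1$, $d(h_i(e_i,e_i))=0$, $-\sqrt{-1}\partial\overline{\partial}\log h_i=\sqrt{-1}\sum_\alpha \mu^{(i)}_\alpha dz_\alpha\wedge d\overline{z_\alpha}$; the curvature vectors are $\bm{\mu}_\alpha=(\mu_\alpha^{(1)},\dots,\mu_\alpha^{(l)})\in\mathbb{R}^l$; (iv) $P$ is an $l$-dimensional Fano polytope with $-\bm{\mu}_\alpha\in\mathrm{Int}(P)$ for all $\alpha$. KSM-manifold: let $Q_{\mathfrak{M}}\to W$ be the $(\mathbb{C}^* )^l$-bundle whose points are $\bm{q}=q_1\oplus\dots\oplus q_l$ with $q_i\in L_i\setminus(\text{zero-section})$. For $\bm{a}\in\mathbb{Z}^l$ put $\bm{q}^{\bm{a}}=q_1^{\otimes a_1}\otimes\dots\otimes q_l^{\otimes a_l}\in \bm{L}^{\bm{a}}=L_1^{\otimes a_1}\otimes\dots\otimes L_l^{\otimes a_l}$. With $P^*\cap\mathbb{Z}^l=\{\bm{a}_0,\dots,\bm{a}_N\}$ and $E_{\mathfrak{M}}=\bigoplus_j\bm{L}^{-\bm{a}_j}$, define $\Phi_{\mathfrak{M}}:Q_{\mathfrak{M}}\to\mathbb{P}(E_{\mathfrak{M}})=(E_{\mathfrak{M}}\setminus(\text{zero-section}))/\mathbb{C}^*$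 by $\bm{q}\mapsto[\bm{q}^{-\bm{a}_0}\oplus\dots\oplus\bm{q}^{-\bm{a}_N}]$. Then $Z_{\mathfrak{M}}$ is the closure of $\Phi_{\mathfrak{M}}(Q_{\mathfrak{M}})$, an $(n+l)$-dimensional Fano manifold. Fiber-directed fields: $(\mathbb{C}^* )^l$ acts on $Z_{\mathfrak{M}}$ (by scaling the $q_i$), and $v_i$ is the holomorphic vector field corresponding to $t_i\frac{\partial}{\partial t_i}\in\mathrm{Lie}((\mathbb{C}^* )^l)$. A fiber-directed $V$ is $V=\sum_k c_kv_k$ with $\bm{c}\in\mathbb{R}^l$. Its Hamiltonian potential, normalized to have integral zero, is written on $P^*$ as $-\langle\bm{c},\bm{z}\rangle+C_V$, where $C_V$ is determined by $\int_{P^*}(-\langle\bm{c},\bm{z}\rangle+C_V)\prod_\alpha(1+\langle\bm{\mu}_\alpha,\bm{z}\rangle)\,d\bm{z}=0$. Admissible $\sigma$: a real-valued smooth function on an interval $(\alpha,\beta)$ with $-\infty\le\alpha<\min_{P^*}(-\langle\bm{c},\bm{z}\rangle+C_V)\le\max_{P^*}(-\langle\bm{c},\bm{z}\rangle+C_V)<\beta\le+\infty$ satisfying either $\dot\sigma\le0\le\ddot\sigma$ or $\ddot\sigma>0$. Put $h(\bm{z})=\prod_{\alpha=1}^n(1+\langle\bm{\mu}_\alpha,\bm{z}\rangle)$, $g(\bm{z})=h(\bm{z})e^{-\sigma(-\langle\bm{c},\bm{z}\rangle+C_V)}$, $|P^*|_h=\int_{P^*}h\,d\bm{z}$, $|P^*|_V^\sigma=\int_{P^*}g\,d\bm{z}$.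 Function spaces: $v_{P^*}(\bm{y})=\sup_{\bm{z}\in P^*}\langle\bm{y},\bm{z}\rangle$; $u^*(\bm{z})=\sup_{\bm{y}\in\mathbb{R}^l}(\langle\bm{y},\bm{z}\rangle-u(\bm{y}))$ is the Legendre dual; $\mathrm{PSH}(P^* )$ is the set of convex $u:\mathbb{R}^l\to\mathbb{R}$ with $u\le v_{P^*}+C$ for some constant $C$; $\mathcal{E}^1(P^* )=\{u\in\mathrm{PSH}(P^* ):\int_{P^*}u^*\,d\bm{z}<+\infty\}$. The $(\sigma,V)$-Ding functional is, for $u\in\mathcal{E}^1(P^* )$, $$D_V^\sigma(u)=\frac{1}{|P^*|_V^\sigma}\int_{P^*}u^*(\bm{z})g(\bm{z})\,d\bm{z}-\log\int_{\mathbb{R}^l}e^{-u(\bm{y})}\,d\bm{y}.$$ The reduced $J$-functional is $$J_{\mathrm{red}}(u)=\inf_{\ell}\left\{\frac{1}{|P^*|_h}\int_{P^*}(u^*-\ell)h\,d\bm{z}-\inf_{P^*}(u^*-\ell)\right\},$$ $\ell$ running over all affine functions on $P^*$. $D_V^\sigma$ is coercive if there exist constants $\delta,C>0$ such that $D_V^\sigma(u)\ge\delta J_{\mathrm{red}}(u)-C$ for all $u\in\mathcal{E}^1(P^* )$. *)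

(* Defs.v *)
From HB Require Import structures.
From mathcomp Require Import all_boot all_order all_algebra.
From mathcomp Require Import all_classical all_reals all_analysis.
From mathcomp Require Import complex.

Set Implicit Arguments.
Unset Strict Implicit.
Unset Printing Implicit Defensive.

Import Order.TTheory GRing.Theory Num.Theory.
Import numFieldNormedType.Exports.

Local Open Scope classical_set_scope.
Local Open Scope ring_scope.

Section measurable_rV.
Context (R : realType) (n : nat).

Let coors : 'I_n -> 'rV[R]_n -> measurableTypeR R := fun i v => v ord0 i.

Let rV_set0 : g_sigma_preimage coors set0.
Proof. exact: sigma_algebra0. Qed.

Let rV_setC A : g_sigma_preimage coors A -> g_sigma_preimage coors (~` A).
Proof. exact: sigma_algebraC. Qed.

Let rV_bigcup (F : _^nat) : (forall i, g_sigma_preimage coors (F i)) ->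
  g_sigma_preimage coors (\bigcup_i (F i)).
Proof. exact: sigma_algebra_bigcup. Qed.

HB.instance Definition _ := @isMeasurable.Build default_measure_display
  'rV[R]_n (g_sigma_preimage coors) rV_set0 rV_setC rV_bigcup.

Lemma measurable_coord (i : 'I_n) :
  measurable_fun setT (fun v : 'rV[R]_n => v ord0 i : measurableTypeR R).
Proof.
move=> _ Y mY; rewrite setTI; apply: sub_sigma_algebra => /=.
rewrite -bigcup_seq/=; exists i => /=; first by rewrite mem_index_enum.
by exists Y => //; rewrite setTI.
Qed.

Lemma measurable_fun_rVP d (T : measurableType d) (f : T -> 'rV[R]_n) :
  measurable_fun setT f <->
  forall i, measurable_fun setT (fun x => f x ord0 i : measurableTypeR R).
Proof.
split=> [mf i|mf].
  exact: (measurableT_comp (measurable_coord i) mf).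
have sub : g_sigma_preimage (fun i => coors i \o f) `<=` measurable.
  apply: smallest_sub; first exact: sigma_algebra_measurable.
  rewrite -bigcup_seq; apply: bigcup_sub => i _ A [B mB <-].
  exact: mf.
move=> _ A mA; rewrite setTI; apply: sub.
by rewrite g_sigma_preimage_comp; exists A => //; rewrite setTI.
Qed.

End measurable_rV.

Section lebesgue_rV.
Context (R : realType).

Definition cons_rV n (p : measurableTypeR R * 'rV[R]_n) : 'rV[R]_n.+1 :=
  row_mx (p.1)%:M p.2.

Lemma cons_rV0 n p : @cons_rV n p ord0 ord0 = p.1.
Proof.
rewrite /cons_rV (_ : ord0 = lshift n (ord0 : 'I_1)); last exact: val_inj.
by rewrite (@row_mxEl _ 1 1 n) mxE eqxx mulr1n.
Qed.

Lemma cons_rVS n p (i : 'I_n) : @cons_rV n p ord0 (lift ord0 i) = p.2 ord0 i.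
Proof.
rewrite /cons_rV (_ : lift ord0 i = rshift 1 i); last exact: val_inj.
by rewrite (@row_mxEr _ 1 1 n).
Qed.

Lemma measurable_cons_rV n : measurable_fun setT (@cons_rV n).
Proof.
apply/measurable_fun_rVP => i.
case: (unliftP ord0 i) => [j ->|->].
  under eq_fun do rewrite cons_rVS.
  exact: (measurableT_comp (measurable_coord j) measurable_snd).
by under eq_fun do rewrite cons_rV0; exact: measurable_fst.
Qed.

Section step.
Context (n : nat) (m : {sigma_finite_measure set 'rV[R]_n -> \bar R}).

Definition lebesgue_rV_step : set 'rV[R]_n.+1 -> \bar R :=
  pushforward (lebesgue_measure \x m)%E (@cons_rV n).

Let step0 : lebesgue_rV_step set0 = 0%E.
Proof. by rewrite /lebesgue_rV_step /pushforward preimage_set0 measure0. Qed.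

Let step_ge0 A : (0 <= lebesgue_rV_step A)%E.
Proof. by rewrite /lebesgue_rV_step /pushforward; exact: measure_ge0. Qed.

Let step_sigma_additive : semi_sigma_additive lebesgue_rV_step.
Proof.
move=> F mF tF mUF.
exact: (measure_semi_sigma_additive
  (s := measure_function_pushforward__canonical__measure_function_Measure _
    (@measurable_cons_rV n))).
Qed.

HB.instance Definition _ :=
  isMeasure.Build _ _ _ lebesgue_rV_step step0 step_ge0 step_sigma_additive.

Let step_sigma_finite : sigma_finite setT lebesgue_rV_step.
Proof.
have /sigma_finiteP[F [TF ndF Foo]] := sigma_finiteT (@lebesgue_measure R).
have /sigma_finiteP[G [TG ndG Goo]] := sigma_finiteT m.
exists (fun k => (fun v : 'rV[R]_n.+1 => v ord0 ord0) @^-1` F k `&`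
    (fun v : 'rV[R]_n.+1 => \row_i v ord0 (lift ord0 i)) @^-1` G k).
  apply/esym; rewrite -subTset => v _ /=.
  have [i _ Fi] : (\bigcup_k F k) (v ord0 ord0) by rewrite -TF.
  have [j _ Gj] : (\bigcup_k G k) (\row_i v ord0 (lift ord0 i)) by rewrite -TG.
  exists (maxn i j) => //; split.
    by have /subsetPset := ndF _ _ (leq_maxl i j); apply.
  by have /subsetPset := ndG _ _ (leq_maxr i j); apply.
move=> k; have [mF Fk] := Foo k; have [mG Gk] := Goo k; split.
  apply: measurableI.
    by rewrite -[X in measurable X]setTI; exact: measurable_coord.
  rewrite -[X in measurable X]setTI.
  suff : measurable_fun setT
    (fun v : 'rV[R]_n.+1 => \row_i v ord0 (lift ord0 i)) by exact.
  apply/measurable_fun_rVP => i /=.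
  by under eq_fun do rewrite mxE; exact: measurable_coord.
rewrite /lebesgue_rV_step /pushforward (_ : _ @^-1` _ = F k `*` G k).
  by rewrite product_measure1E// lte_mul_pinfty// ge0_fin_numE.
apply/seteqP; split=> -[x v] /=; rewrite cons_rV0 /=;
  by rewrite (_ : \row_i _ = v) //; apply/rowP => i; rewrite mxE cons_rVS.
Qed.

HB.instance Definition _ :=
  Measure_isSigmaFinite.Build _ _ _ lebesgue_rV_step step_sigma_finite.

End step.

Fixpoint lebesgue_rV n : {sigma_finite_measure set 'rV[R]_n -> \bar R} :=
  if n is n'.+1 then lebesgue_rV_step (lebesgue_rV n') else \d_(0 : 'rV[R]_0).

End lebesgue_rV.

Lemma lebesgue_rV_box (R : realType) n (A : 'I_n -> set (measurableTypeR R)) :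
  (forall i, measurable (A i)) ->
  lebesgue_rV R n [set v | forall i, A i (v ord0 i)] =
  (\prod_(i < n) lebesgue_measure (A i))%E.
Proof.
have mbox k (B : 'I_k -> set (measurableTypeR R)) :
    (forall i, measurable (B i)) ->
    measurable [set v : 'rV[R]_k | forall i, B i (v ord0 i)].
  move=> mB; rewrite (_ : mkset _ =
      \big[setI/setT]_(i < k) ((fun v : 'rV[R]_k => v ord0 i) @^-1` B i)).
    apply: big_rec => [|i X _ mX]; first exact: measurableT.
    apply: measurableI => //.
    by rewrite -[X in measurable X]setTI; exact: measurable_coord.
  rewrite -bigcap_seq; apply/seteqP; split=> v /= vB i.
    by move=> _; exact: vB.
  by apply: (vB i); exact: mem_index_enum.
move=> mA; elim: n A mA => [|n IH] A mA.
  by rewrite big_ord0 /= diracE mem_set// => -[].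
rewrite big_ord_recl /= /lebesgue_rV_step /pushforward.
rewrite (_ : _ @^-1` _ = A ord0 `*`
    [set v : 'rV[R]_n | forall i, A (lift ord0 i) (v ord0 i)]).
  rewrite product_measure1E; 
    [|exact: mA|]; first by rewrite (IH (fun i => A (lift ord0 i))).
  by apply: (mbox n (fun i => A (lift ord0 i))) => i; exact: mA.
apply/seteqP; split=> [[x v] /= H|[x v] /= [H0 H] i].
  by split=> [|i]; [have := H ord0|have := H (lift ord0 i)];
    rewrite (cons_rV0, cons_rVS).
by case: (unliftP ord0 i) => [j ->|->]; rewrite (cons_rV0, cons_rVS) //=.
Qed.

(* C^n is modelled by ['rV[R]_(n + n)]: the complex coordinates of a point are
   z_a = x_a + i y_a, with the x_a the first n entries and the y_a the last n. *)

Section complex_coordinates.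
Context (R : realType).
Local Notation C := R[i].
Local Open Scope complex_scope.

Definition partials m (s : seq 'I_m) (f : 'rV[R]_m -> R) : 'rV[R]_m -> R :=
  foldr (fun j g x => 'D_(delta_mx ord0 j) g x) f s.

Definition smooth_on m (O : set 'rV[R]_m) (f : 'rV[R]_m -> R) :=
  forall (s : seq 'I_m) x, O x ->
    {for x, continuous (partials s f)} /\
    (forall j, derivable (partials s f) x (delta_mx ord0 j)).

Definition csmooth_on m (O : set 'rV[R]_m) (f : 'rV[R]_m -> C) :=
  smooth_on O (fun x => complex.Re (f x)) /\
  smooth_on O (fun x => complex.Im (f x)).

Definition cpartial m (j : 'I_m) (f : 'rV[R]_m -> C) (x : 'rV[R]_m) : C :=
  'D_(delta_mx ord0 j) (fun y => complex.Re (f y)) x +i*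
  'D_(delta_mx ord0 j) (fun y => complex.Im (f y)) x.

Section with_dimension.
Context (n : nat).
Local Notation Cn := 'rV[R]_(n + n).

Definition zcoord (a : 'I_n) (x : Cn) : C :=
  x ord0 (lshift n a) +i* x ord0 (rshift n a).

(* The Wirtinger derivatives d/dz_a and d/d\bar z_a. *)
Definition dz (a : 'I_n) (f : Cn -> C) (x : Cn) : C :=
  2%:R^-1 * (cpartial (lshift n a) f x - 'i * cpartial (rshift n a) f x).

Definition dzbar (a : 'I_n) (f : Cn -> C) (x : Cn) : C :=
  2%:R^-1 * (cpartial (lshift n a) f x + 'i * cpartial (rshift n a) f x).

Definition holomorphic_on (O : set Cn) (f : Cn -> C) :=
  csmooth_on O f /\ forall x, O x -> forall a, dzbar a f x = 0.

End with_dimension.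

Definition adjmx m n (A : 'M[C]_(m, n)) : 'M[C]_(n, m) := map_mx conjc A^T.

(* The order of [R[i]] makes [0 < z] say that [z] is real and positive. *)
Definition posdef n (A : 'M[C]_n) :=
  adjmx A = A /\
  forall v : 'rV[C]_n, v != 0 -> 0 < (v *m A *m adjmx v) ord0 ord0.

End complex_coordinates.

(* [chart_map] and [chart_inv] are only meaningful on [chart_dom] and on its image. *)
Record chart (R : realType) (n : nat) (W : topologicalType) := Chart {
  chart_dom : set W;
  chart_map : W -> 'rV[R]_(n + n);
  chart_inv : 'rV[R]_(n + n) -> W;
  chart_dom_open : open chart_dom;
  chart_img_open : open (chart_map @` chart_dom);
  chart_mapK : forall w, chart_dom w -> chart_inv (chart_map w) = w;
  chart_map_cont : forall w, chart_dom w -> {for w, continuous chart_map};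
  chart_inv_cont : forall x, (chart_map @` chart_dom) x ->
    {for x, continuous chart_inv} }.

Definition chart_change (R : realType) (n : nat) (W : topologicalType)
    (k k' : chart R n W) (x : 'rV[R]_(n + n)) : 'rV[R]_(n + n) :=
  chart_map k' (chart_inv k x).

Definition holomorphic_change (R : realType) (n : nat) (W : topologicalType)
    (k k' : chart R n W) :=
  forall a, holomorphic_on (chart_map k @` (chart_dom k `&` chart_dom k'))
                           (fun x => zcoord a (chart_change k k' x)).

(* The atlas is maximal, so its elements are all the holomorphic coordinate systems. *)
Record complex_manifold (R : realType) (n : nat) := ComplexManifold {
  space :> topologicalType;
  atlas : set (chart R n space);
  space_hausdorff : hausdorff_space space;
  space_countable : @second_countable space;
  atlas_cover : forall w : space, exists2 k, atlas k & chart_dom k w;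
  atlas_compat : forall k k', atlas k -> atlas k' -> holomorphic_change k k';
  atlas_maximal : forall k,
    (forall k', atlas k' -> holomorphic_change k k' /\ holomorphic_change k' k) ->
    atlas k }.

Section forms.
Context (R : realType) (n : nat) (W : complex_manifold R n).
Local Notation C := R[i].
Local Open Scope complex_scope.
Implicit Types (k : chart R n W) (w : W).

Definition smooth_at_chart k (O : set W) (f : W -> R) :=
  smooth_on (chart_map k @` (chart_dom k `&` O)) (f \o chart_inv k).

Definition mfd_smooth_on (O : set W) (f : W -> R) :=
  forall k, atlas k -> smooth_at_chart k O f.

Definition mfd_holomorphic_on (O : set W) (f : W -> C) :=
  forall k, atlas k ->
    holomorphic_on (chart_map k @` (chart_dom k `&` O)) (f \o chart_inv k).

(* The matrix of the dz'_b / dz_a, with z the coordinates of k and z' those of k'. *)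
Definition jac k k' w : 'M[C]_n :=
  \matrix_(a, b) dz a (fun x => zcoord b (chart_change k k' x)) (chart_map k w).

(* A (1,1)-form i \sum_(a,b) G_ab dz_a /\ d\bar z_b is given by its coefficient
   matrices G in all charts of the atlas. *)
Definition form11 := chart R n W -> W -> 'M[C]_n.

Definition is_form11 (G : form11) :=
  (forall k k' w, atlas k -> atlas k' -> chart_dom k w -> chart_dom k' w ->
     G k w = jac k k' w *m G k' w *m adjmx (jac k k' w)) /\
  (forall k, atlas k -> forall a b,
     csmooth_on (chart_map k @` chart_dom k) (fun x => G k (chart_inv k x) a b)).

(* For a Hermitian G, d-closedness says that dG_bc/dz_a is symmetric in a and b. *)
Definition closed_form11 (G : form11) :=
  forall k w, atlas k -> chart_dom k w -> forall a b c,
    dz a (fun x => G k (chart_inv k x) b c) (chart_map k w) =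
    dz b (fun x => G k (chart_inv k x) a c) (chart_map k w).

Definition positive_form11 (G : form11) :=
  forall k w, atlas k -> chart_dom k w -> posdef (G k w).

Definition kahler_form (G : form11) :=
  [/\ is_form11 G, positive_form11 G & closed_form11 G].

(* The coefficient matrix of -i \partial\bar\partial f in the chart k. *)
Definition minus_ddbar k (f : W -> R) w : 'M[C]_n :=
  \matrix_(a, b)
    - dz a (dzbar b (fun x => (f (chart_inv k x))%:C)) (chart_map k w).

(* Ric = -i \partial\bar\partial log det G *)
Definition ricci (G : form11) : form11 :=
  fun k => minus_ddbar k (fun w => ln (complex.Re (\det (G k w)))).

(* A Hermitian metric on the anticanonical bundle, given by the squared norms
   r k of the frames d/dz_1 /\ ... /\ d/dz_n in all charts of the atlas. *)
Definition anticanonical_metric (r : chart R n W -> W -> R) :=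
  [/\ forall k, atlas k -> smooth_at_chart k (chart_dom k) (r k),
      forall k w, atlas k -> chart_dom k w -> 0 < r k w
    & forall k k' w, atlas k -> atlas k' -> chart_dom k w -> chart_dom k' w ->
        (r k w)%:C = `| \det (jac k k' w) | ^+ 2 * (r k' w)%:C].

(* A Fano manifold is connected, compact and has a positive anticanonical bundle. *)
Definition fano_manifold :=
  [/\ [set: W] !=set0, connected [set: W], compact [set: W]
    & exists2 r, anticanonical_metric r &
        positive_form11 (fun k => minus_ddbar k (fun w => ln (r k w)))].

End forms.

Record local_section (R : realType) (X : topologicalType)
    (fiber : X -> lmodType R[i]) := LocalSection {
  sec_dom : set X;
  sec_val : forall w, fiber w }.

Section frames.
Context (R : realType) (n : nat) (W : complex_manifold R n).
Context (fiber : W -> lmodType R[i]).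

(* [sec_val e] is a basis of every fibre over [sec_dom e]. *)
Definition is_frame (e : local_section fiber) :=
  open (sec_dom e) /\
  forall w, sec_dom e w ->
    sec_val e w != 0 /\ (forall v : fiber w, exists a : R[i], v = a *: sec_val e w).

Definition frame_change (e e' : local_section fiber) :=
  exists2 f : W -> R[i], mfd_holomorphic_on (sec_dom e `&` sec_dom e') f &
    forall w, sec_dom e w -> sec_dom e' w -> sec_val e' w = f w *: sec_val e w.

End frames.

(* A holomorphic line bundle is given by its fibres and by the (maximal) set of
   its holomorphic local frames. *)
Record line_bundle (R : realType) (n : nat) (W : complex_manifold R n) :=
  LineBundle {
  fiber : W -> lmodType R[i];
  frames : set (local_section fiber);
  frames_basis : forall e, frames e -> is_frame e;
  frames_cover : forall w, exists2 e, frames e & sec_dom e w;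
  frames_compat : forall e e', frames e -> frames e' -> frame_change e e';
  frames_maximal : forall e, is_frame e ->
    (forall e', frames e' -> frame_change e e' /\ frame_change e' e) -> frames e }.

(* The value [hform h w] is C-linear in its first argument. *)
Record hermitian_metric (R : realType) (n : nat) (W : complex_manifold R n)
    (L : line_bundle W) := HermitianMetric {
  hform : forall w, fiber L w -> fiber L w -> R[i];
  hform_linear : forall w (a : R[i]) (x y z : fiber L w),
    hform (a *: x + y) z = a * hform x z + hform y z;
  hform_conj : forall w (x y : fiber L w), hform y x = conjc (hform x y);
  hform_pos : forall w (x : fiber L w), x != 0 -> 0 < hform x x;
  hform_smooth : forall e, frames e ->
    mfd_smooth_on (sec_dom e)
      (fun w => complex.Re (hform (sec_val e w) (sec_val e w))) }.

Section hermitian_metrics.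
Context (R : realType) (n : nat) (W : complex_manifold R n) (L : line_bundle W).
Implicit Types (h : hermitian_metric L) (e : local_section (fiber L)).

Definition sqnorm h e (w : W) : R :=
  complex.Re (hform h (sec_val e w) (sec_val e w)).

(* The coefficient matrix of -i \partial\bar\partial log h(e,e) in the chart k. *)
Definition curvature h e (k : chart R n W) (w : W) : 'M[R[i]]_n :=
  minus_ddbar k (fun w' => ln (sqnorm h e w')) w.

End hermitian_metrics.

Section polytopes.
Context (R : realType) (l : nat).
Implicit Types (P F : set 'rV[R]_l).

Definition dotv (x y : 'rV[R]_l) : R := \sum_(i < l) x ord0 i * y ord0 i.

Definition conv_hull m (p : 'I_m -> 'rV[R]_l) : set 'rV[R]_l :=
  [set x | exists t : 'I_m -> R,
    [/\ forall i, 0 <= t i, \sum_(i < m) t i = 1 & x = \sum_(i < m) t i *: p i]].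

Definition polytope P := exists m (p : 'I_m -> 'rV[R]_l), P = conv_hull p.

Definition aff_indep m (p : 'I_m -> 'rV[R]_l) :=
  forall t : 'I_m -> R, \sum_(i < m) t i = 0 -> \sum_(i < m) t i *: p i = 0 ->
    forall i, t i = 0.

(* The affine hull of F has dimension r - 1. *)
Definition aff_rank F r :=
  (exists2 p : 'I_r -> 'rV[R]_l, (forall i, F (p i)) & aff_indep p) /\
  ~ (exists2 p : 'I_r.+1 -> 'rV[R]_l, (forall i, F (p i)) & aff_indep p).

Definition face P F := exists (a : 'rV[R]_l) (b : R),
  (forall x, P x -> dotv a x <= b) /\ F = P `&` [set x | dotv a x = b].

Definition vertices P : set 'rV[R]_l := [set v | face P [set v]].

(* For P of dimension l, these are the faces of dimension l - 1. *)
Definition facet P F := face P F /\ aff_rank F l.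

Definition simplex F :=
  exists m (p : 'I_m -> 'rV[R]_l), aff_indep p /\ F = conv_hull p.

Definition lattice_vec (x : 'rV[int]_l) : 'rV[R]_l := map_mx intr x.

Definition Z_basis (B : 'I_l -> 'rV[int]_l) :=
  forall x : 'rV[int]_l, exists! a : 'I_l -> int, x = \sum_(i < l) a i *: B i.

Definition fano_polytope P :=
  polytope P /\
  [/\ vertices P `<=` range lattice_vec,
      interior P 0,
      forall F, facet P F -> simplex F
    & forall F, facet P F -> exists2 B : 'I_l -> 'rV[int]_l, Z_basis B &
        vertices F = range (fun i => lattice_vec (B i))].

Definition dual_polytope P : set 'rV[R]_l :=
  [set z | forall y, P y -> dotv z y <= 1].

End polytopes.

Record KSM_data (R : realType) (n l : nat) := KSMData {
  ksm_W : complex_manifold R n;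
  ksm_nu : form11 ksm_W;
  ksm_L : 'I_l -> line_bundle ksm_W;
  ksm_metric : forall i, hermitian_metric (ksm_L i);
  (* the curvature vectors: the entry i of [ksm_mu a] is \mu_a^(i) *)
  ksm_mu : 'I_n -> 'rV[R]_l;
  ksm_P : set 'rV[R]_l;
  ksm_fano : fano_manifold ksm_W;
  ksm_kahler : kahler_form ksm_nu;
  ksm_einstein : forall k w, atlas k -> chart_dom k w ->
    ricci ksm_nu k w = ksm_nu k w;
  ksm_eigenvalues : forall i k e w, atlas k -> chart_dom k w ->
    frames e -> sec_dom e w ->
    char_poly (curvature (ksm_metric i) e k w *m invmx (ksm_nu k w)) =
    \prod_(a < n) ('X - (real_complex R (ksm_mu a ord0 i))%:P);
  ksm_normal_coordinates : forall w, exists (k : chart R n ksm_W)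
      (e : forall i, local_section (fiber (ksm_L i))),
    [/\ atlas k, chart_dom k w, forall i, frames (e i) /\ sec_dom (e i) w,
        ksm_nu k w = 1%:M
      & forall i,
        [/\ sqnorm (ksm_metric i) (e i) w = 1,
            forall j, 'D_(delta_mx ord0 j)
              (fun x => sqnorm (ksm_metric i) (e i) (chart_inv k x))
              (chart_map k w) = 0
          & curvature (ksm_metric i) (e i) k w =
            diag_mx (\row_a real_complex R (ksm_mu a ord0 i))]];
  ksm_polytope : fano_polytope ksm_P;
  ksm_interior : forall a, interior ksm_P (- ksm_mu a) }.

Section ding.
Context (R : realType) (n l : nat) (M : KSM_data R n l).
Implicit Types (c z y : 'rV[R]_l) (CV : R) (sigma : R -> R) (u : 'rV[R]_l -> R).

Local Notation Pstar := (dual_polytope (ksm_P M)).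
Local Notation leb := (lebesgue_rV R l).

Definition ksm_h z : R := \prod_(a < n) (1 + dotv (ksm_mu M a) z).

(* A fiber-directed field V = \sum_k c_k v_k is given by its coefficients c; this is
   its Hamiltonian potential on the dual polytope, with additive constant CV = C_V. *)
Definition potential c CV z : R := - dotv c z + CV.

Definition normalized c CV :=
  (\int[leb]_(z in Pstar) (potential c CV z * ksm_h z))%R = 0.

Definition ksm_g c CV sigma z : R := ksm_h z * expR (- sigma (potential c CV z)).

Definition ksm_vol : R := (\int[leb]_(z in Pstar) ksm_h z)%R.

Definition ksm_vol_sigma c CV sigma : R :=
  (\int[leb]_(z in Pstar) ksm_g c CV sigma z)%R.

(* [sigma] only matters on the interval ]alpha, beta[. *)
Definition admissible c CV (alpha beta : \bar R) sigma :=
  let I := [set x : R | (alpha < x%:E < beta)%E] in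
  [/\ (alpha < ereal_inf [set (potential c CV z)%:E | z in Pstar])%E,
      (ereal_sup [set (potential c CV z)%:E | z in Pstar] < beta)%E,
      forall m x, I x -> derivable (derive1n m sigma) x 1
    & (forall x, I x -> derive1n 1 sigma x <= 0 <= derive1n 2 sigma x) \/
      (forall x, I x -> 0 < derive1n 2 sigma x)].

Definition support_fun y : R := sup [set dotv y z | z in Pstar].

Definition legendre u z : \bar R :=
  ereal_sup [set (dotv y z - u y)%:E | y in [set: 'rV[R]_l]].

Definition PSH u :=
  @convex_function R 'rV[R]_l setT u /\
  exists C : R, forall y, u y <= support_fun y + C.

Definition E1 u := PSH u /\ (\int[leb]_(z in Pstar) legendre u z < +oo)%E.

Definition ding c CV sigma u : \bar R :=
  (((ksm_vol_sigma c CV sigma)^-1)%:E *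
     \int[leb]_(z in Pstar) (legendre u z * (ksm_g c CV sigma z)%:E)
   - lne (\int[leb]_y (expR (- u y))%:E))%E.

Definition Jred u : \bar R :=
  ereal_inf [set ((ksm_vol^-1)%:E *
        \int[leb]_(z in Pstar) ((legendre u z - (dotv ab.1 z + ab.2)%:E) *
                                (ksm_h z)%:E)
      - ereal_inf [set (legendre u z - (dotv ab.1 z + ab.2)%:E) | z in Pstar])%E
    | ab in [set: 'rV[R]_l * R]].

Definition ding_coercive c CV sigma :=
  exists delta C : R, [/\ 0 < delta, 0 < C &
    forall u, E1 u -> (delta%:E * Jred u - C%:E <= ding c CV sigma u)%E].

End ding.

(* Main.v *)
Require Import Defs.
From mathcomp Require Import all_boot all_order all_algebra.
From mathcomp Require Import all_classical all_reals all_analysis.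
From mathcomp Require Import ring lra measurable_realfun.

Import Order.TTheory GRing.Theory Num.Theory.
Import numFieldNormedType.Exports.
Local Open Scope classical_set_scope.
Local Open Scope ring_scope.

(** Write Q for the dual polytope, g for the weight e^(-sigma) h and u^* for the
    Legendre transform of u.  The set Q is measurable and lies between two cubes
    centred at 0 ([between_cubes]), and g and h are measurable and bounded above
    and away from 0 on Q ([weight]).  The affine factors of h are bounded away from 0
    because each point -mu_a is interior to the polytope, and e^(-sigma) is
    because the potential takes values in a compact interval on which sigma is
    continuous.  The theorem then says that the Ding functional weighted by g is
    coercive exactly when the barycenter of g is 0.

    If it is coercive, test it on the support function v_Q translated by a
    vector p.  The Legendre transform of this function is the linear form
    <p, z> on Q, so the first term of the Ding functional is the pairing of p
    with the barycenter; the logarithmic term is bounded above independently of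
    p, and J_red is nonnegative.  A linear function of p that is bounded below
    is 0 ([barycenter0_of_coercive]).

    Conversely, let the barycenter be 0.  For every a, the function
    f_a = u^* - <a, .> + u(a) is nonnegative on Q, and its integral controls the
    growth of u around a: u(y) - u(a) >= r |y - a|_1 - M, where M is 1 plus the
    quotient of the integral of f_a by the volume of a cube of side r
    ([legendre_growth]).  Indeed f_a is at most M somewhere on the cube of side
    r, contained in Q, whose points have coordinates of the signs of y - a and
    of size at least r.  The growth shows that u is bounded below, so that one
    may choose a with u(a) <= inf u + 1.  Taking the convex combination of
    the two lower bounds r |y - a|_1 - M and -1 of u(y) - u(a) with a small
    coefficient t for the first one gives
    log (integral of e^-u) <= -u(a) + t M + const.  The barycenter condition
    turns the first term of the Ding functional into the g-average of f_a minus
    u(a).  The values u(a) cancel, and t is chosen to make t M at most half of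
    that average plus a constant; the other half dominates a multiple of J_red,
    which the affine function <a, .> - u(a) bounds by the h-average of f_a
    ([weighted_ding_coercive]). *)

(** * Measurability in R^n *)

Section lebesgue_rV_measure.
Context {R : realType}.

Lemma measurable_box {n} (B : 'I_n -> set (measurableTypeR R)) :
  (forall i, measurable (B i)) ->
  measurable [set v : 'rV[R]_n | forall i, B i (v ord0 i)].
Proof.
move=> mB; rewrite (_ : mkset _ =
    \big[setI/setT]_(i < n) ((fun v : 'rV[R]_n => v ord0 i) @^-1` B i)).
  apply: big_rec => [|i X _ mX]; first exact: measurableT.
  apply: measurableI => //.
  by rewrite -[X in measurable X]setTI; exact: measurable_coord.
rewrite -bigcap_seq; apply/seteqP; split=> v /= vB i.
  by move=> _; exact: vB.
by apply: (vB i); exact: mem_index_enum.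
Qed.

(** The sigma-algebra of R^n is generated by the coordinates; it contains the
    open sets because they are countable unions of boxes with rational
    centres. *)
Lemma open_measurable_rV {n} (O : set 'rV[R]_n) : open O -> measurable O.
Proof.
move=> oO.
pose box (p : 'rV[rat]_n * nat) :=
  [set v : 'rV[R]_n |
    forall i, ball (ratr (p.1 ord0 i) : R) p.2.+1%:R^-1 (v ord0 i)].
pose F p := if `[< box p `<=` O >] then box p else set0.
rewrite (_ : O = \bigcup_p F p).
  apply: countable_bigcupT_measurable => [|p]; first exact: countableP.
  rewrite /F; case: ifP => // _.
  have mb i : measurable (ball (ratr (p.1 ord0 i) : R) p.2.+1%:R^-1).
    exact: measurable_ball.
  exact: (measurable_box _ mb).
apply/seteqP; split=> [x Ox|x [p _]]; last first.
  by rewrite /F; case: ifPn => // /asboolP; exact.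
have /nbhs_ballP[e /= e0 eO] := open_nbhs_nbhs (conj oO Ox).
have e20 : 0 < e / 2 by rewrite divr_gt0.
have [k] := ltr_add_invr e20; rewrite add0r => ke.
have /choice[q qP] : forall i : 'I_n, exists q : rat,
    ball (ratr q : R) k.+1%:R^-1 (x ord0 i).
  move=> i.
  have /rat_in_itvoo[q] : x ord0 i - k.+1%:R^-1 < x ord0 i + k.+1%:R^-1.
    by rewrite ltrD2l gt0_cp// invr_gt0.
  rewrite in_itv/= => /andP[q1 q2]; exists q.
  by rewrite /ball/= ltr_distl q1 q2.
exists (\row_i q i, k) => //; rewrite /F ifT.
  by move=> i; rewrite mxE.
apply/asboolP => v vB; apply: eO; split=> // i j; rewrite ord1.
have := vB j; rewrite /= mxE => vj; have qj := qP j.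
move: vj qj; rewrite /ball/= => vj qj.
rewrite (_ : x ord0 j - v ord0 j =
  (ratr (q j) - v ord0 j) - (ratr (q j) - x ord0 j)); last by ring.
apply: le_lt_trans (ler_normB _ _) _.
by rewrite (splitr e) ltrD// (lt_trans _ ke)//.
Qed.

Lemma measurable_dotv {n} (a : 'rV[R]_n) : measurable_fun setT (dotv a).
Proof.
rewrite /dotv; under eq_fun do rewrite -(big_enum _)/=.
apply: measurable_sum => i.
by apply: measurable_funM => //; exact: measurable_coord.
Qed.

Lemma continuous_dotv {n} (a : 'rV[R]_n) : continuous (dotv a).
Proof.
move=> x; rewrite /dotv.
apply: (@cvg_big R 'I_n +%R 0 xpredT _ _ (nbhs x)) => [|i _].
  exact: add_continuous.
apply: cvgM; first exact: cvg_cst.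
exact: coord_continuous.
Qed.

(** A supremum of affine functions is lower semicontinuous: its superlevel sets
    are unions of open half-spaces. *)
Lemma measurable_legendre {n} (u : 'rV[R]_n -> R) :
  measurable_fun setT (legendre u).
Proof.
apply: (measurability _ (ErealGenOInfty.measurableE R)).
move=> /= _ [_ [b ->]] <-; rewrite setTI; apply: open_measurable_rV.
rewrite (_ : _ @^-1` _ = \bigcup_y (dotv y @^-1` [set x | b + u y < x])).
  apply: bigcup_open => y _; apply: open_comp; last exact: open_gt.
  by move=> x _; exact: continuous_dotv.
apply/seteqP; split=> z /=.
  rewrite in_itv/= andbT /legendre => /ereal_sup_gt[_ [y _ <-]].
  by rewrite lte_fin => yb; exists y => //=; lra.
move=> [y _ /= yb]; rewrite in_itv/= andbT.
apply: (@lt_le_trans _ _ (dotv y z - u y)%:E); first by rewrite lte_fin; lra.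
by apply: ereal_sup_ubound; exists y.
Qed.

End lebesgue_rV_measure.

(** * Exponential integrals *)

Section exponential_integral.
Context {R : realType}.

(** The integral of a nonnegative function is a supremum over the simple
    functions below it, so comparison holds for arbitrary functions, such
    as e^-u for an arbitrary u. *)
Lemma le_ge0_integral {d} {T : measurableType d} (mu : {measure set T -> \bar R})
    (f g : T -> \bar R) :
  (forall x, (0 <= f x)%E) -> (forall x, (f x <= g x)%E) ->
  (\int[mu]_x f x <= \int[mu]_x g x)%E.
Proof.
move=> f0 fg; have g0 x : (0 <= g x)%E by exact: le_trans (f0 x) (fg x).
rewrite !ge0_integralTE//; apply: ereal_sup_le => _ [h hf <-].
by exists h => // x; exact: le_trans (hf x) (fg x).
Qed.

Lemma continuous_exp_norm (r a : R) :
  continuous (fun x : R => expR (- (r * `|x - a|))).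
Proof.
move=> x; apply: continuous_comp; last exact: continuous_expR.
apply: (@continuousN _ R^o); apply: continuousM; first exact: cst_continuous.
apply: continuous_comp; last exact: norm_continuous.
by apply: continuousB => //; exact: cst_continuous.
Qed.

Lemma integral_exp_norm0 (r : R) : 0 < r ->
  (\int[lebesgue_measure]_x (expR (- (r * `|x|)))%:E = (2 / r)%:E)%E.
Proof.
move=> r0.
have cf : continuous (fun x : R => expR (- (r * `|x|))).
  by have := continuous_exp_norm r 0; under eq_fun do rewrite subr0.
rewrite ge0_symfun_integralT//; last by move=> x /=; rewrite normrN.
have mpos : measurable [set x : R | 0 <= x] by rewrite -set_itvcy.
suff -> : (\int[lebesgue_measure]_(x in [set x : R | (0 <= x)%R])
    (expR (- (r * `|x|)))%:E)%E = (r^-1)%:E by rewrite -EFinM.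
transitivity (\int[lebesgue_measure]_x
    ((r^-1)%:E * (exponential_pdf r x)%:E))%E; last first.
  rewrite ge0_integralZl//; last 3 first.
  - by apply/measurable_EFinP; exact: measurable_exponential_pdf.
  - by move=> x _; rewrite lee_fin; apply: exponential_pdf_ge0; exact: ltW.
  - by rewrite lee_fin invr_ge0 ltW.
  by rewrite integral_exponential_pdf// mule1.
rewrite integral_mkcond; apply: eq_integral => x _; rewrite patchE.
case: ifPn => [|]; rewrite ?inE ?notin_setE /= => x0.
  rewrite exponential_pdfE//= ger0_norm// -EFinM mulrA mulVf ?gt_eqF//.
  by rewrite mul1r mulNr.
by rewrite lt0_exponential_pdf ?mule0// ltNge; apply/negP.
Qed.

Lemma integral_exp_norm (r a : R) : 0 < r ->
  (\int[lebesgue_measure]_x (expR (- (r * `|x - a|)))%:E = (2 / r)%:E)%E.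
Proof.
move=> r0; rewrite -(integral_exp_norm0 _ r0).
have F'E : (fun x : R => x - a)^`()%classic = cst 1.
  apply/funext => x; rewrite derive1E deriveB// derive_id derive_cst subr0//.
rewrite [RHS](@increasing_ge0_integration_by_substitutionT _ (fun x => x - a)).
- by apply: eq_integral => x _; rewrite F'E/= mulr1.
- by move=> x y xy; rewrite ltrD2r.
- by rewrite F'E => ?; exact: cvg_cst.
- by rewrite F'E; exact: is_cvg_cst.
- by rewrite F'E; exact: is_cvg_cst.
- by move=> x; exact: derivableB.
- exact: cvg_addrr_Ny.
- exact: cvg_addrr.
- by have := continuous_exp_norm r 0; under eq_fun do rewrite subr0.
- by move=> x; exact: expR_ge0.
Qed.

Lemma measurable_exp_norm1 {n} (r : R) (a : 'rV[R]_n) :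
  measurable_fun setT (fun y : 'rV[R]_n =>
    (expR (- (r * \sum_(i < n) `|y ord0 i - a ord0 i|)))%:E).
Proof.
apply/measurable_EFinP; apply: measurableT_comp => //.
apply: measurableT_comp => //; apply: measurable_funM => //.
apply: measurable_sum => i; apply: measurableT_comp => //.
by apply: measurable_funB => //; exact: measurable_coord.
Qed.

(** The centre [a] will be a near-minimizer of the function under study, over
    which there is no control: the value must not depend on it. *)
Lemma integral_exp_norm1 {n} (r : R) (a : 'rV[R]_n) : 0 < r ->
  (\int[lebesgue_rV R n]_y
     (expR (- (r * \sum_(i < n) `|y ord0 i - a ord0 i|)))%:E =
   ((2 / r) ^+ n)%:E)%E.
Proof.
move=> r0.
elim: n a => [|n IH] a.
  rewrite expr0 /= integral_dirac//=; last exact: measurable_exp_norm1.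
  by rewrite diracT mul1e big_ord0 mulr0 oppr0 expR0.
transitivity (\int[pushforward (lebesgue_measure \x lebesgue_rV R n)%E
    (@cons_rV R n)]_y
  (expR (- (r * \sum_(i < n.+1) `|y ord0 i - a ord0 i|)))%:E)%E; first by [].
rewrite ge0_integral_pushforward//; last 2 first.
- exact: measurable_cons_rV.
- exact: measurable_exp_norm1.
rewrite preimage_setT fubini_tonelli1//=; last first.
  exact: (measurableT_comp (measurable_exp_norm1 r a) (@measurable_cons_rV R n)).
pose a' : 'rV[R]_n := \row_i a ord0 (lift ord0 i).
transitivity (\int[lebesgue_measure]_x
   ((expR (- (r * `|x - a ord0 ord0|)))%:E * ((2 / r) ^+ n)%:E))%E.
  apply: eq_integral => x _; rewrite -(IH a') -ge0_integralZl//; last first.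
    exact: measurable_exp_norm1.
  apply: eq_integral => y _; rewrite -EFinM -expRD; congr (expR _)%:E.
  rewrite big_ord_recl cons_rV0 mulrDr opprD; congr (_ - _ * _).
  by apply: eq_bigr => i _; rewrite cons_rVS mxE.
rewrite ge0_integralZr//; last 2 first.
- apply/measurable_EFinP; apply: continuous_measurable_fun.
  exact: continuous_exp_norm.
- by rewrite lee_fin exprn_ge0// divr_ge0 ?ltW.
by rewrite integral_exp_norm// -EFinM -exprS.
Qed.

End exponential_integral.

(** * Legendre transforms and growth *)

Section growth.
Context {R : realType}.

Lemma dotvBl {n} (x y z : 'rV[R]_n) : dotv (x - y) z = dotv x z - dotv y z.
Proof. by rewrite /dotv -sumrB; apply: eq_bigr => i _; rewrite !mxE mulrBl. Qed.

Lemma ge_legendre {n} (u : 'rV[R]_n -> R) y z :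
  ((dotv y z - u y)%:E <= legendre u z)%E.
Proof. by apply: ereal_sup_ubound; exists y. Qed.

(** Markov's inequality; the summand 1 replaces the strictness that is lost when
    [f x > X / b] is integrated over [B]. *)
Lemma exists_le_integral {d} {T : measurableType d} (mu : {measure set T -> \bar R})
    (A B : set T) (f : T -> \bar R) (b X : R) :
  measurable A -> measurable B -> B `<=` A -> 0 < b -> mu B = b%:E ->
  measurable_fun A f -> (forall x, A x -> (0 <= f x)%E) ->
  (\int[mu]_(x in A) f x <= X%:E)%E ->
  exists2 x, B x & (f x <= (X / b + 1)%:E)%E.
Proof.
move=> mA mB BA b0 muB mf f0 fX; apply: contrapT => nex.
have fB x : B x -> ((X / b + 1)%:E <= f x)%E.
  move=> Bx; rewrite leNgt; apply/negP => /ltW fx.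
  by apply: nex; exists x.
have X0 : 0 <= X by rewrite -lee_fin; apply: le_trans fX; exact: integral_ge0.
have : (\int[mu]_(x in B) (cst (X / b + 1)%:E x) <= X%:E)%E.
  apply: le_trans fX; apply: (@le_trans _ _ (\int[mu]_(x in B) f x)%E).
    apply: ge0_le_integral => //.
    - by move=> x _; rewrite lee_fin addr_ge0// divr_ge0// ltW.
    - exact: measurable_funS mf.
  exact: ge0_subset_integral.
rewrite integral_cst// muB -EFinM lee_fin mulrDl mul1r divfK ?gt_eqF//.
by rewrite gerDl leNgt b0.
Qed.

(** The corner box [C] of the points whose coordinates have the signs of those
    of [y - a] and size between [r] and [2 * r] has volume [r ^+ n].  At a point
    [w] of [C] where the integrand is small, [dotv y w - u y <= legendre u w]
    bounds [u y] from below, and [dotv (y - a) w] is at least [r] times the l^1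
    norm of [y - a]. *)
Lemma legendre_growth {n} (u : 'rV[R]_n -> R) (Q : set 'rV[R]_n) (r X : R)
    (a : 'rV[R]_n) :
  measurable Q -> 0 < r ->
  (forall z : 'rV[R]_n, (forall i, `|z ord0 i| <= 2 * r) -> Q z) ->
  (\int[lebesgue_rV R n]_(z in Q) (legendre u z - (dotv a z - u a)%:E)
    <= X%:E)%E ->
  forall y : 'rV[R]_n,
    u a + r * \sum_(i < n) `|y ord0 i - a ord0 i| - (X / r ^+ n + 1)
    <= u y.
Proof.
move=> mQ r0 boxQ fX y.
pose B (i : 'I_n) : set (measurableTypeR R) :=
  if 0 <= y ord0 i - a ord0 i then `[r, 2 * r]%classic
  else `[- (2 * r), - r]%classic.
have mB i : measurable (B i) by rewrite /B; case: ifP => _; exact: measurable_itv.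
have muB i : lebesgue_measure (B i) = r%:E.
  rewrite /B; case: ifP => _; rewrite lebesgue_measure_itv/= lte_fin ifT -?EFinB.
  - by congr (_%:E); lra.
  - lra.
  - by congr (_%:E); lra.
  - lra.
pose C := [set v : 'rV[R]_n | forall i, B i (v ord0 i)].
have mC : measurable C by exact: measurable_box.
have CQ : C `<=` Q.
  move=> v Cv; apply: boxQ => i; have := Cv i; rewrite /B ler_norml.
  by case: ifP => _ /=; rewrite in_itv/= => /andP[? ?]; apply/andP; split; lra.
have muC : lebesgue_rV R n C = (r ^+ n)%:E.
  rewrite lebesgue_rV_box// (eq_bigr (fun=> r%:E)) => [|i _]; last exact: muB.
  by rewrite prodEFin prodr_const card_ord.
have [||w Cw fw] :=
    exists_le_integral (lebesgue_rV R n) _ _ _ _ _ mQ mC CQ (exprn_gt0 n r0) muC _ _ fX.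
- apply: emeasurable_funB.
    by apply: measurable_funTS; exact: measurable_legendre.
  apply/measurable_EFinP; apply: measurable_funTS.
  by apply: measurable_funB => //; exact: measurable_dotv.
- by move=> z _; rewrite sube_ge0//; exact: ge_legendre.
have le1 : ((dotv y w - u y)%:E <= (X / r ^+ n + 1 + (dotv a w - u a))%:E)%E.
  apply: le_trans (ge_legendre _ _ _) _.
  by rewrite EFinD -leeBlDr.
have le2 : r * \sum_(i < n) `|y ord0 i - a ord0 i| <= dotv (y - a) w.
  rewrite /dotv mulr_sumr; apply: ler_sum => i _; rewrite !mxE.
  have := Cw i; rewrite /B; case: ifPn => [y0|]; rewrite ?in_itv/=.
    move=> /andP[w1 _]; rewrite ger0_norm// mulrC.
    by rewrite ler_wpM2l.
  rewrite -ltNge in_itv/= => y0 /andP[_ w1]; rewrite ltr0_norm// mulrN -mulNr mulrC.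
  by rewrite ler_wnM2l// ltW.
by move: le1 le2; rewrite lee_fin dotvBl; lra.
Qed.

End growth.

(** * Weights on domains between two cubes *)

Section weighted_functionals.
Context {R : realType} {n : nat}.
Implicit Types (Q : set 'rV[R]_n) (f g h : 'rV[R]_n -> R).
Implicit Types (u : 'rV[R]_n -> R) (a y z : 'rV[R]_n).
Local Notation leb := (lebesgue_rV R n).

(** The Ding functional and the reduced J-functional of the theorem, with the
    dual polytope and the two weights replaced by an arbitrary set and arbitrary
    functions. *)
Definition weighted_ding Q g u : \bar R :=
  (((\int[leb]_(z in Q) g z)%R^-1)%:E *
     \int[leb]_(z in Q) (legendre u z * (g z)%:E)
   - lne (\int[leb]_y (expR (- u y))%:E))%E.

Definition weighted_J Q h u : \bar R :=
  ereal_inf [set (((\int[leb]_(z in Q) h z)%R^-1)%:E *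
        \int[leb]_(z in Q) ((legendre u z - (dotv ab.1 z + ab.2)%:E) * (h z)%:E)
      - ereal_inf [set (legendre u z - (dotv ab.1 z + ab.2)%:E) | z in Q])%E
    | ab in [set: 'rV[R]_n * R]].

Definition cube (a : 'rV[R]_n) (s : R) : set 'rV[R]_n :=
  [set z | forall i, `|z ord0 i - a ord0 i| <= s].

(** The inner cube has half-side [2 * r], so that it contains the corner boxes
    of side [r] of [legendre_growth]. *)
Definition between_cubes Q r b :=
  [/\ 0 < r, 0 < b, forall z : 'rV[R]_n, (forall i, `|z ord0 i| <= 2 * r) -> Q z
    & forall z, Q z -> forall i, `|z ord0 i| <= b].

Definition weight Q g m k :=
  [/\ measurable_fun Q g, 0 < m & forall z, Q z -> m <= g z <= k].

Section domain.
Context {Q} {r b : R} (mQ : measurable Q) (cQ : between_cubes Q r b).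

Lemma cubeE (s : R) (a : 'rV[R]_n) : cube a s =
  [set z : 'rV[R]_n | forall i,
    `[a ord0 i - s, a ord0 i + s]%classic (z ord0 i)].
Proof.
by apply/seteqP; split=> z /= zi i; have := zi i; rewrite in_itv/= ler_distl.
Qed.

Lemma cube_volume (s : R) (a : 'rV[R]_n) : 0 < s ->
  leb (cube a s) = ((2 * s) ^+ n)%:E.
Proof.
move=> s0; rewrite cubeE.
rewrite (@lebesgue_rV_box R n
  (fun i => `[a ord0 i - s, a ord0 i + s]%classic)); last first.
  by move=> i; exact: measurable_itv.
rewrite (eq_bigr (fun=> (2 * s)%:E)) => [|i _].
  by rewrite prodEFin prodr_const card_ord.
rewrite lebesgue_measure_itv/= lte_fin ifT; last by lra.
by rewrite -EFinB; congr (_%:E); lra.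
Qed.

Lemma measurable_cube (s : R) (a : 'rV[R]_n) :
  measurable (cube a s).
Proof.
rewrite cubeE.
have mI i : measurable (`[a ord0 i - s, a ord0 i + s]%classic : set (measurableTypeR R)).
  exact: measurable_itv.
exact: (measurable_box _ mI).
Qed.

Lemma domain_lty : (leb Q < +oo)%E.
Proof.
have [_ b0 _ Qb] := cQ.
apply: (@le_lt_trans _ _ (leb (cube 0 b))).
  apply: le_measure; rewrite ?inE//; first exact: measurable_cube.
  by move=> z Qz i /=; rewrite mxE subr0; exact: Qb.
by rewrite cube_volume// ltry.
Qed.

Lemma domain_gt0 : (0 < leb Q)%E.
Proof.
have [r0 _ cubQ _] := cQ.
apply: (@lt_le_trans _ _ (leb (cube 0 (2 * r)))).
  by rewrite cube_volume ?mulr_gt0// lte_fin exprn_gt0// !mulr_gt0.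
apply: le_measure; rewrite ?inE//; first exact: measurable_cube.
by move=> z zr; apply: cubQ => i; have := zr i; rewrite mxE subr0.
Qed.

Lemma bounded_integrable f (k : R) : measurable_fun Q f ->
  (forall z, Q z -> `|f z| <= k) -> leb.-integrable Q (EFin \o f).
Proof.
move=> mf fk; apply: measurable_bounded_integrable => //; first exact: domain_lty.
exists k; split; first exact: num_real.
by move=> x kx z Qz /=; apply: le_trans (fk _ Qz) (ltW kx).
Qed.

Lemma dotv_bound a z : Q z -> `|dotv a z| <= (\sum_(i < n) `|a ord0 i|) * b.
Proof.
have [_ _ _ Qb] := cQ; move=> Qz; rewrite mulr_suml.
apply: le_trans (ler_norm_sum _ _ _) _; apply: ler_sum => i _.
by rewrite normrM ler_wpM2l// Qb.
Qed.

Context {g : 'rV[R]_n -> R} {m k : R} (wg : weight Q g m k).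

Lemma weight_bound f c : measurable_fun Q f -> (forall z, Q z -> `|f z| <= c) ->
  leb.-integrable Q (EFin \o (fun z => f z * g z)).
Proof.
have [mg m0 mgk] := wg; move=> mf fc.
apply: (@bounded_integrable _ (c * k)); first exact: measurable_funM.
move=> z Qz; rewrite normrM; apply: ler_pM => //; first exact: fc.
have /andP[mz zk] := mgk _ Qz.
by rewrite ger0_norm// (le_trans (ltW m0)).
Qed.

Lemma weight_integrable : leb.-integrable Q (EFin \o g).
Proof.
have m1 : measurable_fun Q (cst 1 : 'rV[R]_n -> R) by exact: measurable_cst.
have := @weight_bound (cst 1) 1 m1.
rewrite (_ : (fun z => cst 1 z * g z) = g); last first.
  by apply/funext => z; rewrite /= mul1r.
by apply=> z _; rewrite /= normr1.
Qed.

Lemma EFin_Rintegral f : leb.-integrable Q (EFin \o f) ->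
  ((\int[leb]_(z in Q) f z)%R%:E = \int[leb]_(z in Q) (f z)%:E)%E.
Proof. by move=> fi; rewrite fineK//; exact: integrable_fin_num. Qed.

Lemma weight_volume_gt0 : 0 < (\int[leb]_(z in Q) g z)%R.
Proof.
have [mg m0 mgk] := wg.
rewrite -lte_fin EFin_Rintegral; last exact: weight_integrable.
apply: (@lt_le_trans _ _ (\int[leb]_(z in Q) (cst m%:E z))%E).
  rewrite integral_cst//; apply: mule_gt0; first by rewrite lte_fin.
  exact: domain_gt0.
apply: ge0_le_integral => //.
- by move=> z _; rewrite lee_fin ltW.
- exact/measurable_EFinP.
- by move=> z Qz; rewrite lee_fin; case/andP: (mgk z Qz).
Qed.

Lemma integrable_coord_weight i :
  leb.-integrable Q (EFin \o (fun z => z ord0 i * g z)).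
Proof.
have [_ _ _ Qb] := cQ.
apply: (@weight_bound _ b); last by move=> z Qz; exact: Qb.
by apply: measurable_funTS; exact: measurable_coord.
Qed.

Lemma integrable_dotv_weight a :
  leb.-integrable Q (EFin \o (fun z => dotv a z * g z)).
Proof.
apply: weight_bound; last by move=> z; exact: dotv_bound.
by apply: measurable_funTS; exact: measurable_dotv.
Qed.

Lemma integral_dotv_weight a :
  (\int[leb]_(z in Q) (dotv a z * g z))%R =
  \sum_(i < n) a ord0 i * (\int[leb]_(z in Q) (z ord0 i * g z))%R.
Proof.
apply: EFin_inj; rewrite EFin_Rintegral; last exact: integrable_dotv_weight.
under eq_integral do rewrite /dotv mulr_suml -sumEFin.
rewrite integral_sum//; last first.
  move=> i; have := integrableZl mQ (a ord0 i) (integrable_coord_weight i).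
  by apply: eq_integrable => // z _ /=; rewrite -EFinM mulrA.
rewrite -sumEFin; apply: eq_bigr => i _.
rewrite EFinM EFin_Rintegral; last exact: integrable_coord_weight.
rewrite -integralZl//; last exact: integrable_coord_weight.
by apply: eq_integral => z _; rewrite -EFinM mulrA.
Qed.

End domain.

End weighted_functionals.

(** * Coercivity for weights with barycenter 0 *)

Section coercivity.
Context {R : realType} {n : nat}.
Implicit Types (Q : set 'rV[R]_n) (f g h : 'rV[R]_n -> R) (u : 'rV[R]_n -> R).
Implicit Types (a y z : 'rV[R]_n).
Local Notation leb := (lebesgue_rV R n).

Context {Q} {r b : R} (mQ : measurable Q) (cQ : between_cubes Q r b).

(** Since [legendre u z >= - u 0], only the positive part of the transform can
    have an infinite integral. *)
Lemma legendre_integrable u : (\int[leb]_(z in Q) legendre u z < +oo)%E ->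
  leb.-integrable Q (legendre u).
Proof.
move=> uoo; have mL : measurable_fun Q (legendre u).
  by apply: measurable_funTS; exact: measurable_legendre.
have Ln : (\int[leb]_(z in Q) (legendre u)^\-%E z < +oo)%E.
  apply: (@le_lt_trans _ _ (\int[leb]_(z in Q) (cst `|u 0|%:E z))%E).
    apply: ge0_le_integral => //; first exact: measurable_funeneg.
    move=> z _; rewrite funenegE ge_max; apply/andP; split; last by rewrite lee_fin.
    rewrite leeNl; apply: le_trans (ge_legendre u 0 z).
    rewrite -EFinN lee_fin lerNl opprB lerBlDr.
    apply: (le_trans (ler_norm _)).
    by rewrite lerDl /dotv big1// => i _; rewrite mxE mul0r.
  rewrite integral_cst//; apply: lte_mul_pinfty => //.
  exact: (domain_lty mQ cQ).
apply/integrableP; split => //.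
rewrite (_ : integral _ _ _ = \int[leb]_(z in Q)
    ((legendre u)^\+%E z + (legendre u)^\-%E z))%E; last first.
  by apply: eq_integral => z _; rewrite -[LHS]/((abse \o _) z) fune_abse.
rewrite ge0_integralD//; last 2 first.
- exact: measurable_funepos.
- exact: measurable_funeneg.
apply: lte_add_pinfty => //; rewrite ltNge; apply/negP.
rewrite leye_eq => /eqP Lp; move: uoo Ln; rewrite integralE Lp.
by case: (\int[leb]_(z in Q) (legendre u)^\-%E z)%E.
Qed.

Lemma near_minimizer u (B : R) : (forall y, B <= u y) ->
  exists a, forall y, u a <= u y + 1.
Proof.
move=> uB; have lbB : lbound (range u) B by move=> _ [y _ <-]; exact: uB.
have [|_ [a _ <-] ua] := @inf_adherent _ (range u) _ ltr01.
  by split; [exists (u 0), 0|exists B].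
exists a => y; apply: le_trans (ltW ua) _; rewrite lerD2r.
by apply: ge_inf; [exists B|exists y].
Qed.

Lemma lne_le (x y : \bar R) : (0 <= x)%E -> (x <= y)%E -> (lne x <= lne y)%E.
Proof.
move=> x0 xy; rewrite lee_lne// in_itv/= ?leey ?andbT//.
exact: le_trans xy.
Qed.

Lemma lne_integral_exp u a (t c : R) : 0 < t ->
  (forall y, c + t * \sum_(i < n) `|y ord0 i - a ord0 i| <= u y) ->
  (lne (\int[leb]_y (expR (- u y))%:E) <= (- c + ln ((2 / t) ^+ n))%:E)%E.
Proof.
move=> t0 uc.
have e0 : 0 < (2 / t) ^+ n by rewrite exprn_gt0// divr_gt0.
have -> : (- c + ln ((2 / t) ^+ n))%:E = lne (expR (- c) * (2 / t) ^+ n)%:E.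
  by rewrite lne_EFin ?mulr_gt0 ?expR_gt0// lnM ?posrE ?expR_gt0// expRK.
apply: lne_le; first by apply: integral_ge0 => y _; rewrite lee_fin expR_ge0.
rewrite EFinM -(integral_exp_norm1 _ a t0) -ge0_integralZl//; last first.
  exact: measurable_exp_norm1.
apply: le_ge0_integral => y; first by rewrite lee_fin expR_ge0.
by rewrite -EFinM lee_fin -expRD ler_expR -opprD lerN2.
Qed.

End coercivity.

Section sufficiency.
Context {R : realType} {n : nat}.
Implicit Types (Q : set 'rV[R]_n) (f g h : 'rV[R]_n -> R) (u : 'rV[R]_n -> R).
Implicit Types (a y z : 'rV[R]_n).
Local Notation leb := (lebesgue_rV R n).

(** The constants: [t] makes [t * M] at most half of the [g]-average of the
    normalized transform plus 1, and [delta] is what remains after comparing the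
    averages against [h] and [g] through [k' / m]. *)
Lemma weighted_ding_coercive Q (r b : R) g h (m k m' k' : R) :
  measurable Q -> between_cubes Q r b -> weight Q g m k -> weight Q h m' k' ->
  (forall i : 'I_n, (\int[leb]_(z in Q) (z ord0 i * g z))%R = 0) ->
  exists delta C : R, [/\ 0 < delta, 0 < C & forall u,
    (\int[leb]_(z in Q) legendre u z < +oo)%E ->
    (delta%:E * weighted_J Q h u - C%:E <= weighted_ding Q g u)%E].
Proof.
move=> mQ cQ wg wh bary.
set Vg := (\int[leb]_(z in Q) g z)%R.
set Vh := (\int[leb]_(z in Q) h z)%R.
have Vg0 : 0 < Vg := weight_volume_gt0 mQ cQ wg.
have Vh0 : 0 < Vh := weight_volume_gt0 mQ cQ wh.
have [r0 b0 cubQ Qb] := cQ.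
have [mg m0 gb] := wg; have [mh m'0 hb] := wh.
have k'0 : 0 < k'.
  have /andP[h1 h2] : m' <= h 0 <= k'.
    by apply: hb; apply: cubQ => i; rewrite mxE normr0 mulr_ge0// ltW.
  exact: lt_le_trans m'0 (le_trans h1 h2).
have rn0 : 0 < r ^+ n by rewrite exprn_gt0.
pose t := Num.min 1 (m * r ^+ n / (2 * Vg)).
have t0 : 0 < t by rewrite lt_min ltr01 divr_gt0// mulr_gt0.
have t1 : t <= 1 by rewrite ge_min lexx.
pose L0 := ln ((2 / (t * r)) ^+ n).
exists (Vh * m / (2 * k' * Vg)), (`|L0| + 2); split.
- by rewrite divr_gt0 ?mulr_gt0.
- by rewrite ltr_wpDl.
move=> u uoo; have iL := legendre_integrable mQ cQ _ uoo.
pose f a z := (legendre u z - (dotv a z - u a)%:E)%E.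
have f0 a z : (0 <= f a z)%E by rewrite sube_ge0//; exact: ge_legendre.
have mA a : measurable_fun Q (fun z => dotv a z - u a).
  apply: measurable_funTS; apply: measurable_funB => //; exact: measurable_dotv.
have iA a : leb.-integrable Q (EFin \o (fun z => dotv a z - u a)).
  apply: (bounded_integrable mQ cQ _ ((\sum_(i < n) `|a ord0 i|) * b + `|u a|)) => //.
  move=> z Qz; apply: le_trans (ler_normB _ _) _; rewrite lerD2r.
  exact: (dotv_bound cQ).
have If a : leb.-integrable Q (f a) := integrableB mQ iL (iA a).
pose X a := fine (\int[leb]_(z in Q) f a z)%E.
have XE a : (\int[leb]_(z in Q) f a z)%E = (X a)%:E.
  by rewrite fineK//; exact: integrable_fin_num.
have growth a y :
    u a + r * \sum_(i < n) `|y ord0 i - a ord0 i| - (X a / r ^+ n + 1) <= u y.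
  by apply: (legendre_growth _ _ _ _ _ mQ r0 cubQ); rewrite XE.
have [a ua] : exists a, forall y, u a <= u y + 1.
  apply: (near_minimizer u (u 0 - (X 0 / r ^+ n + 1))) => y.
  apply: le_trans (growth 0 y); rewrite lerD2r lerDl mulr_ge0 ?(ltW r0)//.
  exact: sumr_ge0.
pose M := X a / r ^+ n + 1.
(* the convex combination, with coefficient t, of the growth bound and of the
   bound u a - 1 given by the choice of a *)
have interp y :
    u a - t * M - 1 + t * r * \sum_(i < n) `|y ord0 i - a ord0 i| <= u y.
  move: (growth a y) (ua y); rewrite -/M.
  move: (\sum_(i < n) _) (u a) (u y) => s v w; nra.
have := lne_integral_exp u a (t * r) _ (mulr_gt0 t0 r0) interp; rewrite -/L0 => lneE.
have iG (F : 'rV[R]_n -> \bar R) w (p q : R) :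
    leb.-integrable Q F -> weight Q w p q ->
    leb.-integrable Q (fun z => F z * (w z)%:E)%E.
  move=> iF [mw p0 wpq]; apply: (integrableMl mQ) => //.
  exists q; split; first exact: num_real.
  move=> x qx z Qz /=; have /andP[w1 w2] := wpq _ Qz.
  by rewrite ger0_norm ?(le_trans (ltW p0))// (le_trans w2)// ltW.
pose Y := fine (\int[leb]_(z in Q) (f a z * (g z)%:E))%E.
have YE : (\int[leb]_(z in Q) (f a z * (g z)%:E))%E = Y%:E.
  by rewrite fineK//; apply: integrable_fin_num => //; exact: iG wg.
have mXY : m * X a <= Y.
  rewrite -lee_fin EFinM -XE -YE -integralZl//.
  apply: le_integral => //; [exact: integrableZl|exact: iG wg|].
  move=> z; rewrite inE => Qz; rewrite muleC; apply: lee_pmul => //.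
  - by rewrite lee_fin ltW.
  - by rewrite lee_fin; case/andP: (gb _ Qz).
(* the linear part of legendre u = f a + (dotv a - u a) integrates to 0 against
   g, as the barycenter is 0 *)
have Lg : (\int[leb]_(z in Q) (legendre u z * (g z)%:E))%E = (Y - u a * Vg)%:E.
  transitivity (\int[leb]_(z in Q) (f a z * (g z)%:E +
      ((dotv a z - u a) * g z)%:E))%E.
    apply: eq_integral => z _; rewrite /f EFinM -muleDl//.
      by rewrite subeK.
    by apply: fin_num_adde_defl.
  rewrite integralD//; last 2 first.
  - exact: iG wg.
  - exact: (iG _ _ _ _ (iA a) wg).
  rewrite YE EFinD; congr (_ + _)%E.
  rewrite -EFin_Rintegral//; last exact: (iG _ _ _ _ (iA a) wg).
  congr (_%:E); under eq_Rintegral do rewrite mulrBl.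
  have ig := weight_integrable mQ cQ wg.
  rewrite RintegralB//; last 2 first.
  - exact: (integrable_dotv_weight mQ cQ wg).
  - exact: (integrableZl mQ _ ig).
  rewrite (integral_dotv_weight mQ cQ wg) big1 => [|i _]; last by rewrite bary mulr0.
  by rewrite RintegralZl// sub0r.
(* the affine function dotv a - u a is a competitor in the infimum *)
have J1 : (weighted_J Q h u <= (Vh^-1 * (k' / m * Y))%:E)%E.
  apply: (@le_trans _ _ (Vh^-1%:E * \int[leb]_(z in Q) (f a z * (h z)%:E) -
      ereal_inf [set f a z | z in Q])%E).
    by apply: ereal_inf_lbound; exists (a, - u a).
  rewrite -[leRHS]sube0; apply: leeB; last first.
    by apply: le_ereal_inf_tmp => _ [z _ <-]; exact: f0.
  rewrite EFinM; apply: lee_wpmul2l; first by rewrite lee_fin invr_ge0 ltW.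
  rewrite EFinM -YE -integralZl//; last by apply: iG wg.
  apply: le_integral => //; [exact: iG wh|by apply: integrableZl => //; exact: iG wg|].
  move=> z; rewrite inE => Qz; rewrite muleCA; apply: lee_pmul => //.
    by have /andP[h1 _] := hb _ Qz; rewrite lee_fin (le_trans (ltW m'0)).
  rewrite -EFinM lee_fin mulrAC ler_pdivlMr//.
  have /andP[g1 _] := gb _ Qz; have /andP[h1 h2] := hb _ Qz.
  by apply: ler_pM => //; rewrite ltW// (lt_le_trans m'0).
have X0 : 0 <= X a by apply: fine_ge0; apply: integral_ge0 => z _; exact: f0.
have tM : t * M <= Y / (2 * Vg) + 1.
  rewrite /M mulrDr mulr1; apply: lerD => //.
  apply: (@le_trans _ _ (m * r ^+ n / (2 * Vg) * (X a / r ^+ n))).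
    by rewrite ler_wpM2r ?divr_ge0 ?(ltW rn0)// ge_min lexx orbT.
  rewrite (_ : _ * _ = m * X a / (2 * Vg)); last first.
    by field; rewrite ?gt_eqF.
  by rewrite ler_pM2r// invr_gt0 mulr_gt0.
apply: (@le_trans _ _ (Y / (2 * Vg) - (`|L0| + 2))%:E).
  rewrite EFinB; apply: leeB => //.
  rewrite (_ : Y / (2 * Vg) = (Vh * m / (2 * k' * Vg)) * (Vh^-1 * (k' / m * Y))).
    rewrite [leRHS]EFinM; apply: lee_wpmul2l => //; rewrite lee_fin.
    by rewrite divr_ge0 ?mulr_ge0 ?ltW.
  by field; rewrite ?gt_eqF.
apply: (@le_trans _ _ (Vg^-1 * (Y - u a * Vg) - (- (u a - t * M - 1) + L0))%:E).
  rewrite lee_fin mulrBr mulrCA mulVf ?gt_eqF// mulr1.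
  have := ler_norm L0; have -> : Vg^-1 * Y = Y / (2 * Vg) + Y / (2 * Vg).
    by field; rewrite ?gt_eqF.
  by move: tM; lra.
by rewrite /weighted_ding -/Vg Lg EFinB EFinM; apply: leeB.
Qed.

End sufficiency.

(** * Translated support functions *)

Section translated_support.
Context {R : realType} {n : nat}.
Implicit Types (Q : set 'rV[R]_n) (f g h : 'rV[R]_n -> R) (u : 'rV[R]_n -> R).
Implicit Types (p x y z : 'rV[R]_n).
Local Notation leb := (lebesgue_rV R n).

Lemma dotvDl x y z : dotv (x + y) z = dotv x z + dotv y z.
Proof. by rewrite /dotv -big_split; apply: eq_bigr => i _; rewrite !mxE mulrDl. Qed.

Lemma dotvZl (t : R) y z : dotv (t *: y) z = t * dotv y z.
Proof. by rewrite /dotv mulr_sumr; apply: eq_bigr => i _; rewrite !mxE mulrA. Qed.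

Lemma dotv_basis (t : R) (i : 'I_n) z :
  dotv (t *: delta_mx ord0 i) z = t * z ord0 i.
Proof.
rewrite dotvZl /dotv (bigD1 i)//= big1 ?addr0; first by rewrite mxE !eqxx mul1r.
by move=> j ji; rewrite mxE (negbTE ji) andbF mul0r.
Qed.

Definition support_function Q y : R := sup [set dotv y z | z in Q].

Context {Q} {r b : R} (mQ : measurable Q) (cQ : between_cubes Q r b).

Lemma domain0 : Q 0.
Proof.
by have [r0 _ cubQ _] := cQ; apply: cubQ => i; rewrite mxE normr0 mulr_ge0// ltW.
Qed.

Lemma dotv_le_support y z : Q z -> dotv y z <= support_function Q y.
Proof.
move=> Qz; apply: ub_le_sup; last by exists z.
exists ((\sum_(i < n) `|y ord0 i|) * b) => _ [w Qw <-].
by apply: le_trans (ler_norm _) _; exact: (dotv_bound cQ).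
Qed.

Lemma support_le y (c : R) : (forall z, Q z -> dotv y z <= c) -> support_function Q y <= c.
Proof.
move=> yc; apply: ge_sup; first by exists (dotv y 0), 0 => //; exact: domain0.
by move=> _ [z Qz <-]; exact: yc.
Qed.

(** The supremum over [y] is attained at [y = p], as the support function is 0
    at 0. *)
Lemma legendre_support p z : Q z ->
  legendre (fun y => support_function Q (y - p)) z = (dotv p z)%:E.
Proof.
move=> Qz; apply/eqP; rewrite eq_le; apply/andP; split.
  apply: ge_ereal_sup => _ [y _ <-]; rewrite lee_fin.
  by have := dotv_le_support (y - p) _ Qz; rewrite dotvBl; lra.
apply: ereal_sup_ubound; exists p => //; congr (_%:E).
rewrite subrr (_ : support_function Q 0 = 0) ?subr0//.
have dot0 w : dotv 0 w = 0 by rewrite /dotv big1// => i _; rewrite mxE mul0r.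
apply/eqP; rewrite eq_le; apply/andP; split.
  by apply: support_le => w _; rewrite dot0.
by have := dotv_le_support 0 _ domain0; rewrite dot0.
Qed.

Lemma convex_support p :
  @convex_function R 'rV[R]_n setT (fun y => support_function Q (y - p)).
Proof.
move=> t x y _ _; apply: support_le => z Qz.
rewrite convRE (_ : _ - p = t%:num *: (x - p) + (1 - t%:num) *: (y - p)); last first.
  rewrite -[conv t x y]/(t%:num *: (x : 'rV[R]_n) + (1 - t%:num) *: (y : 'rV[R]_n)).
  by apply/rowP => i; rewrite !mxE; ring.
rewrite dotvDl !dotvZl; apply: lerD.
  by apply: ler_wpM2l => //; exact: dotv_le_support.
apply: ler_wpM2l; last exact: dotv_le_support.
by rewrite subr_ge0.
Qed.

Lemma support_translate_le p y : support_function Q (y - p) <=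
  support_function Q y + support_function Q (- p).
Proof.
by apply: support_le => z Qz; rewrite dotvDl; apply: lerD; exact: dotv_le_support.
Qed.

(** The bound is uniform in [p]: on the unit cube around [p] the translated
    support function is at most [n%:R * b]. *)
Lemma lne_integral_support p :
  ((- (n%:R * b) + ln (2 ^+ n))%:E <=
   lne (\int[leb]_y (expR (- support_function Q (y - p)))%:E))%E.
Proof.
have two0 : 0 < (2 : R) ^+ n by rewrite exprn_gt0.
have -> : (- (n%:R * b) + ln (2 ^+ n))%:E = lne (expR (- (n%:R * b)) * 2 ^+ n)%:E.
  by rewrite lne_EFin ?mulr_gt0 ?expR_gt0// lnM ?posrE ?expR_gt0// expRK.
apply: lne_le; first by rewrite lee_fin mulr_ge0 ?expR_ge0// ltW.
apply: (@le_trans _ _ (\int[leb]_y ((expR (- (n%:R * b)))%:E * (\1_(cube p 1) y)%:E))%E).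
  rewrite ge0_integralZl//; last first.
    by apply/measurable_EFinP; apply: measurable_indic; exact: measurable_cube.
  rewrite integral_indic//; last exact: measurable_cube.
  by have := cube_volume 1 p ltr01; rewrite mulr1 setIT EFinM => <-.
apply: le_ge0_integral => y; first by rewrite -EFinM lee_fin mulr_ge0 ?expR_ge0.
rewrite -EFinM lee_fin indicE; case: (boolP (_ \in _)) => [|_]; last first.
  by rewrite mulr0 expR_ge0.
rewrite inE mulr1 ler_expR lerN2 => yp; apply: support_le => z Qz.
have [_ b0 _ _] := cQ.
apply: le_trans (ler_norm _) _; apply: le_trans (dotv_bound cQ _ _ Qz) _.
rewrite ler_pM2r//; apply: (@le_trans _ _ (\sum_(i < n) 1)); last first.
  by rewrite sumr_const card_ord.
by apply: ler_sum => i _; rewrite !mxE; exact: yp.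
Qed.

End translated_support.

Section necessity.
Context {R : realType} {n : nat}.
Implicit Types (Q : set 'rV[R]_n) (f g h : 'rV[R]_n -> R) (u : 'rV[R]_n -> R).
Implicit Types (p x y z : 'rV[R]_n).
Local Notation leb := (lebesgue_rV R n).

Context {Q} {r b : R} (mQ : measurable Q) (cQ : between_cubes Q r b).

(** On the domain the Legendre transform of a translated support function is
    linear, and its difference with an affine function has an average at least
    its infimum. *)
Lemma weighted_J_support_ge0 h (m k : R) p : weight Q h m k ->
  (0 <= weighted_J Q h (fun y => support_function Q (y - p)))%E.
Proof.
move=> wh; have Vh0 := weight_volume_gt0 mQ cQ wh.
apply: le_ereal_inf_tmp => _ [[a c] _ <-] /=.
pose phi z := dotv (p - a) z - c.
have LE z : Q z -> (legendre (fun y => support_function Q (y - p)) z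
    - (dotv a z + c)%:E = (phi z)%:E)%E.
  by move=> Qz; rewrite (legendre_support cQ)// -EFinB /phi dotvBl opprD addrA.
pose K := (\sum_(i < n) `|(p - a) ord0 i|) * b + `|c|.
have phiK z : Q z -> `|phi z| <= K.
  move=> Qz; apply: le_trans (ler_normB _ _) _; rewrite lerD2r.
  exact: (dotv_bound cQ).
have mphi : measurable_fun Q phi.
  by apply: measurable_funTS; apply: measurable_funB => //; exact: measurable_dotv.
have iphi : leb.-integrable Q (EFin \o (fun z => phi z * h z)).
  exact: (weight_bound mQ cQ wh _ _ mphi phiK).
have -> : [set (legendre (fun y => support_function Q (y - p)) z
      - (dotv a z + c)%:E)%E | z in Q] = [set (phi z)%:E | z in Q].
  by apply/seteqP; split=> _ [z Qz <-]; exists z => //; rewrite LE.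
have -> : (\int[leb]_(z in Q) ((legendre (fun y => support_function Q (y - p)) z
    - (dotv a z + c)%:E) * (h z)%:E))%E = (\int[leb]_(z in Q) (phi z * h z))%R%:E.
  rewrite EFin_Rintegral//; apply: eq_integral => z; rewrite inE => Qz.
  by rewrite LE.
set iota := ereal_inf _.
have iota_le z : Q z -> (iota <= (phi z)%:E)%E.
  by move=> Qz; apply: ereal_inf_lbound; exists z.
have iota_ge : ((- K)%:E <= iota)%E.
  apply: le_ereal_inf_tmp => _ [z Qz <-]; rewrite lee_fin.
  by have := phiK z Qz; rewrite ler_norml => /andP[].
have iotaE : iota = (fine iota)%:E.
  rewrite fineK// fin_numE; apply/andP; split.
    by apply: contraTneq iota_ge => ->; rewrite -ltNge ltNyr.
  by apply: contraTneq (iota_le _ (domain0 cQ)) => ->; rewrite -ltNge ltry.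
rewrite iotaE -EFinM -EFinB lee_fin subr_ge0 mulrC ler_pdivlMr//.
have ih := weight_integrable mQ cQ wh.
rewrite -RintegralZl//; apply: le_Rintegral => //.
  exact: (integrableZl mQ _ ih).
have [_ m0 hb] := wh => z Qz; apply: ler_wpM2r.
  by have /andP[h1 _] := hb z Qz; rewrite (le_trans (ltW m0)).
by rewrite -lee_fin -iotaE; exact: iota_le.
Qed.

(** With [p] a multiple [s] of a basis vector, coercivity bounds from below the
    function of [s] with slope [B / Vg]. *)
Lemma barycenter0_of_coercive g h (m k m' k' delta C : R) :
  weight Q g m k -> weight Q h m' k' -> 0 < delta ->
  (forall u, @convex_function R 'rV[R]_n setT u ->
    (exists c, forall y, u y <= support_function Q y + c) ->
    (\int[leb]_(z in Q) legendre u z < +oo)%E ->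
    (delta%:E * weighted_J Q h u - C%:E <= weighted_ding Q g u)%E) ->
  forall i : 'I_n, (\int[leb]_(z in Q) (z ord0 i * g z))%R = 0.
Proof.
move=> wg wh d0 coer i.
set B := Rintegral _ _ _; set Vg := (\int[leb]_(z in Q) g z)%R.
have Vg0 : 0 < Vg := weight_volume_gt0 mQ cQ wg.
pose L1 := - (n%:R * b) + ln (2 ^+ n).
have key (s : R) : - C <= Vg^-1 * (s * B) - L1.
  pose p : 'rV[R]_n := s *: delta_mx ord0 i.
  pose u y := support_function Q (y - p).
  have LE z : Q z -> legendre u z = (dotv p z)%:E by exact: (legendre_support cQ).
  have uoo : (\int[leb]_(z in Q) legendre u z < +oo)%E.
    rewrite (_ : integral _ _ _ = \int[leb]_(z in Q) (dotv p z)%:E)%E; last first.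
      by apply: eq_integral => z; rewrite inE => Qz; rewrite LE.
    apply: integrable_lty => //.
    apply: (bounded_integrable mQ cQ _ ((\sum_(i < n) `|p ord0 i|) * b)).
      by apply: measurable_funTS; exact: measurable_dotv.
    by move=> z; exact: (dotv_bound cQ).
  have ubu : exists c, forall y, u y <= support_function Q y + c.
    by exists (support_function Q (- p)) => y; exact: (support_translate_le cQ).
  have := coer u (convex_support cQ p) ubu uoo.
  rewrite /weighted_ding -/Vg.
  rewrite (_ : (\int[leb]_(z in Q) (legendre u z * _)) = (s * B)%:E)%E; last first.
    rewrite /B -RintegralZl//; last exact: (integrable_coord_weight mQ cQ wg).
    rewrite EFin_Rintegral//; last first.
      exact: (integrableZl mQ _ (integrable_coord_weight mQ cQ wg i)).
    apply: eq_integral => z; rewrite inE => Qz.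
    by rewrite LE// dotv_basis -EFinM mulrA.
  move=> le1; rewrite -lee_fin.
  apply: (@le_trans _ _ (delta%:E * weighted_J Q h u - C%:E)%E).
    rewrite -[leLHS]add0e EFinN leeB// mule_ge0//; first by rewrite lee_fin ltW.
    exact: (weighted_J_support_ge0 _ _ _ _ wh).
  apply: le_trans le1 _; rewrite EFinB EFinM leeB//.
  exact: (lne_integral_support cQ).
apply/eqP/negPn/negP => B0.
(* this s makes the right hand side of key equal to - (C + `|L1| + 1) - L1 *)
have := key (- (C + `|L1| + 1) * Vg / B).
rewrite divfK// mulrCA mulVf ?gt_eqF// mulr1.
by have := ler_norm (- L1); rewrite normrN; lra.
Qed.

End necessity.

(** * Dual polytopes and their weights *)

Section dual_polytopes.
Context {R : realType} {l : nat}.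
Implicit Types (P : set 'rV[R]_l) (x y z : 'rV[R]_l).

Lemma dotvC x y : dotv x y = dotv y x.
Proof. by apply: eq_bigr => i _; rewrite mulrC. Qed.

Lemma measurable_dual_polytope P : measurable (dual_polytope P).
Proof.
rewrite -[X in measurable X]setCK; apply: measurableC; apply: open_measurable_rV.
rewrite (_ : ~` _ = \bigcup_(y in P) (dotv y @^-1` [set t | 1 < t])).
  apply: bigcup_open => y _; apply: open_comp; last exact: open_gt.
  by move=> z _; exact: continuous_dotv.
apply/seteqP; split=> z /=.
  move=> /existsNP[y /not_implyP[Py /negP]]; rewrite -ltNge => zy.
  by exists y => //=; rewrite dotvC.
by move=> [y Py /=]; rewrite dotvC ltNge => /negP zy; apply/existsNP; exists y => /(_ Py).
Qed.

Lemma polytope_bounded P : polytope P ->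
  exists2 S : R, 0 < S & forall y, P y -> \sum_(i < l) `|y ord0 i| <= S.
Proof.
move=> [m [p ->]]; exists (1 + \sum_(j < m) \sum_(i < l) `|p j ord0 i|).
  by rewrite ltr_wpDr// sumr_ge0// => j _; exact: sumr_ge0.
move=> y [t [t0 t1 ->]].
have t_le1 j : t j <= 1 by rewrite -t1 (bigD1 j)//= lerDl sumr_ge0.
apply: (@le_trans _ _ (\sum_(i < l) \sum_(j < m) `|p j ord0 i|)).
  apply: ler_sum => i _; rewrite summxE; apply: le_trans (ler_norm_sum _ _ _) _.
  apply: ler_sum => j _; rewrite mxE normrM ger0_norm//.
  by rewrite ler_piMl.
by rewrite exchange_big/= lerDr.
Qed.

(** The dual of a bounded set contains a cube, and the dual of a neighbourhood
    of 0 is bounded. *)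
Lemma dual_polytope_between_cubes P : polytope P -> interior P 0 ->
  exists r b : R, between_cubes (dual_polytope P) r b.
Proof.
move=> /polytope_bounded[S S0 PS] /nbhs_ballP[e /= e0 eP].
exists (1 / (2 * S)), (2 / e); split.
- by rewrite divr_gt0// mulr_gt0.
- by rewrite divr_gt0.
- move=> z zr y Py; apply: (@le_trans _ _ (\sum_(i < l) S^-1 * `|y ord0 i|)).
    apply: ler_sum => i _; apply: le_trans (ler_norm _) _; rewrite normrM.
    apply: ler_wpM2r => //; apply: le_trans (zr i) _.
    by rewrite le_eqVlt; apply/orP; left; apply/eqP; field; rewrite gt_eqF.
  by rewrite -mulr_sumr mulrC ler_pdivrMr// mul1r PS.
- move=> z Qz i.
  have coordP (s : R) : `|s| = e / 2 -> s * z ord0 i <= 1.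
    move=> se.
    rewrite -dotv_basis dotvC; apply: Qz; apply: eP; split=> // i' j.
    rewrite !mxE /ball/= sub0r normrN normrM se.
    case: (_ && _); rewrite ?normr1 ?normr0; lra.
  have e2 : 0 < e / 2 by lra.
  have := coordP (e / 2) (gtr0_norm e2).
  have := coordP (- (e / 2)); rewrite normrN => /(_ (gtr0_norm e2)) z1 z2.
  have -> : 2 / e = (e / 2)^-1 by field; rewrite gt_eqF.
  rewrite -[leRHS]mul1r ler_pdivlMr// -{1}(gtr0_norm e2) -normrM ler_norml.
  by apply/andP; split; lra.
Qed.

(** A slightly larger multiple [- (1 + s) *: x] still lies in [P], and pairing
    it with [z] leaves a margin depending on [s] only. *)
Lemma interior_dual_gt0 P x : interior P (- x) ->
  exists2 m : R, 0 < m & forall z, dual_polytope P z -> m <= 1 + dotv x z.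
Proof.
move=> /nbhs_ballP[e /= e0 eP].
have S0 : 0 < 1 + \sum_(i < l) `|x ord0 i| by rewrite ltr_wpDr// sumr_ge0.
pose s := e / (2 * (1 + \sum_(i < l) `|x ord0 i|)).
have s0 : 0 < s by rewrite divr_gt0// mulr_gt0.
exists (s / (1 + s)) => [|z Qz]; first by rewrite divr_gt0// addr_gt0.
have : dotv z ((- (1 + s)) *: x) <= 1.
  apply: Qz; apply: eP; split=> // i' j; rewrite ord1 !mxE /ball/=.
  rewrite (_ : _ - _ = s * x ord0 j); last by ring.
  rewrite normrM gtr0_norm//.
  apply: (@le_lt_trans _ _ (s * (1 + \sum_(i < l) `|x ord0 i|))).
    rewrite ler_pM2l// (bigD1 j)//= addrCA lerDl addr_ge0//.
    exact: sumr_ge0.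
  rewrite (_ : s * _ = e / 2); last by rewrite /s; field; rewrite gt_eqF.
  lra.
rewrite dotvC dotvZl => xz; rewrite ler_pdivrMr ?addr_gt0//.
move: xz; nra.
Qed.

End dual_polytopes.

Section weights.
Context {R : realType} {n : nat}.
Implicit Types (f g : 'rV[R]_n -> R).
Context {Q : set 'rV[R]_n}.

Lemma weightM f g (m k m' k' : R) : weight Q f m k -> weight Q g m' k' ->
  weight Q (fun z => f z * g z) (m * m') (k * k').
Proof.
move=> [mf m0 fb] [mg m'0 gb]; split.
- exact: measurable_funM.
- by rewrite mulr_gt0.
move=> z Qz; have /andP[f1 f2] := fb z Qz; have /andP[g1 g2] := gb z Qz.
have fz0 := lt_le_trans m0 f1; have gz0 := lt_le_trans m'0 g1.
by apply/andP; split; apply: ler_pM => //; exact: ltW.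
Qed.

Lemma weight_prod (I : Type) (s : seq I) (F : I -> 'rV[R]_n -> R) :
  (forall i, exists m k : R, weight Q (F i) m k) ->
  exists m k : R, weight Q (fun z => \prod_(i <- s) F i z) m k.
Proof.
move=> wF; elim: s => [|i s [m [k ws]]].
  exists 1, 1; under eq_fun do rewrite big_nil; split=> // z _.
  by rewrite lexx.
have [m' [k' wi]] := wF i; exists (m' * m), (k' * k).
by under eq_fun do rewrite big_cons; exact: weightM.
Qed.

Lemma weight_affine {r b m : R} (a : 'rV[R]_n) : between_cubes Q r b -> 0 < m ->
  (forall z, Q z -> m <= 1 + dotv a z) ->
  weight Q (fun z => 1 + dotv a z) m (1 + (\sum_(i < n) `|a ord0 i|) * b).
Proof.
move=> cQ m0 am; split=> //.
  apply: measurable_funTS; apply: measurable_funD => //; exact: measurable_dotv.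
move=> z Qz; rewrite am//= lerD2l; apply: le_trans (ler_norm _) _.
exact: (dotv_bound cQ).
Qed.

Lemma weight_exp_comp (sigma : R -> R) (phi : 'rV[R]_n -> R) (p q : R) :
  p <= q -> measurable_fun Q phi -> (forall z, Q z -> p <= phi z <= q) ->
  (forall x, p <= x <= q -> {for x, continuous sigma}) ->
  exists m k : R, weight Q (fun z => expR (- sigma (phi z))) m k.
Proof.
move=> pq mphi phipq csigma.
have cI : {within `[p, q]%classic, continuous sigma}.
  apply: continuous_in_subspaceT => x; rewrite inE/= in_itv/=; exact: csigma.
have [x1 _ max1] := EVT_max pq cI; have [x2 _ min2] := EVT_min pq cI.
exists (expR (- sigma x1)), (expR (- sigma x2)); split.
- apply: measurableT_comp => //; apply: measurableT_comp => //.
  apply: (@measurable_comp _ _ _ _ _ _ `[p, q]%classic) => //.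
    by move=> _ [z Qz <-] /=; rewrite in_itv/=; exact: phipq.
  exact: subspace_continuous_measurable_fun.
- exact: expR_gt0.
- move=> z Qz; rewrite !ler_expR !lerN2 max1 ?min2// in_itv/=; exact: phipq.
Qed.

End weights.

Section ksm_weights.
Context {R : realType} {n l : nat} (M : KSM_data R n l).
Local Notation Pstar := (dual_polytope (ksm_P M)).

Lemma ksm_between_cubes : exists r b : R, between_cubes Pstar r b.
Proof.
by have [polP [_ P0 _ _]] := ksm_polytope M; exact: dual_polytope_between_cubes.
Qed.

Lemma ksm_h_weight : exists m k : R, weight Pstar (ksm_h M) m k.
Proof.
have [r [b cQ]] := ksm_between_cubes.
apply: weight_prod => a; have [m m0 mh] := interior_dual_gt0 _ _ (ksm_interior M a).
by exists m; eexists; exact: (weight_affine _ cQ m0 mh).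
Qed.

(** The infimum and the supremum of the potential are finite, so they bound a
    compact interval inside the domain of [sigma]; there [sigma] is continuous,
    being differentiable. *)
Lemma admissible_weight (c : 'rV[R]_l) (CV : R) (alpha beta : \bar R)
    (sigma : R -> R) : admissible M c CV alpha beta sigma ->
  exists m k : R, weight Pstar (fun z => expR (- sigma (potential c CV z))) m k.
Proof.
move=> [a_inf sup_b dsigma _].
have [r [b cQ]] := ksm_between_cubes.
set E := [set _ | _ in _] in a_inf sup_b.
pose K := (\sum_(i < l) `|c ord0 i|) * b + `|CV|.
have potK z : Pstar z -> `|potential c CV z| <= K.
  move=> Qz; rewrite /potential addrC distrC.
  by apply: le_trans (ler_normB _ _) _; rewrite lerD2r; exact: (dotv_bound cQ).
have infE z : Pstar z -> (ereal_inf E <= (potential c CV z)%:E)%E.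
  by move=> Qz; apply: ereal_inf_lbound; exists z.
have supE z : Pstar z -> ((potential c CV z)%:E <= ereal_sup E)%E.
  by move=> Qz; apply: ereal_sup_ubound; exists z.
have Q0 := domain0 cQ.
have inf_fin : ereal_inf E \is a fin_num.
  rewrite fin_numElt; apply/andP; split; last exact: le_lt_trans (infE 0 Q0) (ltry _).
  apply: (@lt_le_trans _ _ (- K)%:E); first exact: ltNyr.
  apply: le_ereal_inf_tmp => _ [z Qz <-]; rewrite lee_fin.
  by have := potK z Qz; rewrite ler_norml => /andP[].
have sup_fin : ereal_sup E \is a fin_num.
  rewrite fin_numElt; apply/andP; split; first exact: lt_le_trans (ltNyr _) (supE 0 Q0).
  apply: (@le_lt_trans _ _ K%:E); last exact: ltry.
  apply: ge_ereal_sup => _ [z Qz <-]; rewrite lee_fin.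
  by have := potK z Qz; rewrite ler_norml => /andP[].
have potE z : Pstar z ->
    fine (ereal_inf E) <= potential c CV z <= fine (ereal_sup E).
  by move=> Qz; rewrite -!lee_fin !fineK// infE// supE.
apply: (weight_exp_comp sigma _ _ _ _ _ potE).
- by have /andP[p1 p2] := potE 0 Q0; exact: le_trans p2.
- apply: measurable_funTS; apply: measurable_funD => //.
  by apply: measurableT_comp => //; exact: measurable_dotv.
move=> x; rewrite -!lee_fin !fineK// => /andP[x1 x2].
apply: differentiable_continuous; apply/derivable1_diffP.
by apply: (dsigma 0%N) => /=; rewrite (lt_le_trans a_inf x1) (le_lt_trans x2 sup_b).
Qed.

End ksm_weights.

Theorem theorem1p5 (R : realType) (n l : nat) (M : KSM_data R n l)
    (c : 'rV[R]_l) (CV : R) (hCV : normalized M c CV)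
    (alpha beta : \bar R) (sigma : R -> R)
    (hsigma : admissible M c CV alpha beta sigma) :
  ding_coercive M c CV sigma <->
  (forall k : 'I_l,
     (\int[lebesgue_rV R l]_(z in dual_polytope (ksm_P M))
        (z ord0 k * (\prod_(a < n) (1 + dotv (ksm_mu M a) z)) *
         expR (- sigma (- dotv c z + CV))))%R = 0).
Proof.
have [r [b cQ]] := ksm_between_cubes M.
have mQ := measurable_dual_polytope (ksm_P M).
have [m' [k' wh]] := ksm_h_weight M.
have [m1 [k1 ws]] := admissible_weight M c CV alpha beta sigma hsigma.
have wg := weightM _ _ _ _ _ _ wh ws.
under eq_forall do under eq_Rintegral do rewrite -mulrA.
split=> [[delta [C [d0 _ coer]]]|bary].
- apply: (barycenter0_of_coercive mQ cQ _ _ _ _ _ _ _ C wg wh d0) => u cu uQ uoo.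
  by apply: coer; split.
- have [delta [C [d0 C0 coer]]] :=
    weighted_ding_coercive _ _ _ _ _ _ _ _ _ mQ cQ wg wh bary.
  by exists delta, C; split=> // u [_ uoo]; exact: coer.
Qed.
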